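(* Let $H_1,H_2,K_1,K_2$ be Hilbert $\mathfrak{A}$-modules and let $$N=\begin{pmatrix} N_{11} & N_{12}\\ N_{12}^* & N_{22}\end{pmatrix}\in\mathcal{L}(H_1\oplus H_2),\qquad M=\begin{pmatrix} M_{11} & M_{12}\\ M_{12}^* & M_{22}\end{pmatrix}\in\mathcal{L}(K_1\oplus K_2)$$ be positive definite, with Schur complements $S(N)=N_{22}-N_{12}^*N_{11}^{-1}N_{12}$ and $S(M)=M_{22}-M_{12}^*M_{11}^{-1}M_{12}$. Let $$A=\begin{pmatrix} A_{11} & A_{12} \\ A_{21} & A_{22}\end{pmatrix}\in\mathcal{L}(H_1\oplus H_2,K_1\oplus K_2)$$ have a closed range, and let $B=\begin{pmatrix} B_{11} & B_{12} \\ B_{21} & B_{22}\end{pmatrix}\in\mathcal{L}(H_1\oplus H_2,K_1\oplus K_2)$ be given by $$B_{11}=A_{11}+M_{11}^{-1}M_{12}A_{21},$$ $$B_{12}=A_{12}+M_{11}^{-1}M_{12}A_{22}-A_{11}N_{11}^{-1}N_{12}-M_{11}^{-1}M_{12}A_{21}N_{11}^{-1}N_{12},$$ $$B_{21}=A_{21},\qquad B_{22}=A_{22}-A_{21}N_{11}^{-1}N_{12}.$$ Write $$B^\dag_{\mathrm{diag}(M_{11},S(M)),\,\mathrm{diag}(N_{11},S(N))}=\begin{pmatrix} (B^\dag)_{11} & (B^\dag)_{12} \\ (B^\dag)_{21} & (B^\dag)_{22}\end{pmatrix},\qquad A^\dag_{MN}=\begin{pmatrix} (A^\dag_{MN})_{11}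 & (A^\dag_{MN})_{12} \\ (A^\dag_{MN})_{21} & (A^\dag_{MN})_{22}\end{pmatrix},$$ where the $(i,j)$ blocks map $K_j$ to $H_i$. Then $$(A^\dag_{MN})_{11}=(B^\dag)_{11}-N_{11}^{-1}N_{12}(B^\dag)_{21},$$ $$(A^\dag_{MN})_{12}=(B^\dag)_{11}M_{11}^{-1}M_{12}+(B^\dag)_{12}-N_{11}^{-1}N_{12}(B^\dag)_{21}M_{11}^{-1}M_{12}-N_{11}^{-1}N_{12}(B^\dag)_{22},$$ $$(A^\dag_{MN})_{21}=(B^\dag)_{21},\qquad (A^\dag_{MN})_{22}=(B^\dag)_{21}M_{11}^{-1}M_{12}+(B^\dag)_{22}.$$
   Context: $\mathfrak{A}$ is a $C^*$-algebra. For Hilbert $\mathfrak{A}$-modules $H,K$, $\mathcal{L}(H,K)$ is the set of adjointable operators from $H$ to $K$ and $\mathcal{L}(H)=\mathcal{L}(H,H)$. $H_1\oplus H_2$ is the Hilbert $\mathfrak{A}$-module of column pairs with inner product $\langle \binom{x_1}{y_1},\binom{x_2}{y_2}\rangle=\langle x_1,x_2\rangle+\langle y_1,y_2\rangle$. In the block matrices for $A$, $B$, $N$, $M$, the $(i,j)$ block is an adjointable operator from the $j$-th summand of the domain to the $i$-th summand of the codomain. An operator in $\mathcal{L}(K)$ is called positive definite if it is positive and invertible in $\mathcal{L}(K)$; since $M$ and $N$ are positive definite, so are $M_{11},S(M),N_{11},S(N)$. For $T\in\mathcal{L}(H,K)$ and positive definite $M'\in\mathcal{L}(K)$, $N'\in\mathcal{L}(H)$,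 the weighted Moore-Penrose inverse $T^\dag_{M'N'}$ (also written $T^\dag_{M',N'}$) is the (unique if it exists) $X\in\mathcal{L}(K,H)$ with $TXT=T$, $XTX=X$, $(M'TX)^*=M'TX$, $(N'XT)^*=N'XT$; it exists if and only if the range of $T$ is closed. In the present situation $B$ has closed range because $A$ does. *)

(* Defs.v *)
From HB Require Import structures.
From mathcomp Require Import all_boot all_order all_algebra complex.
From mathcomp Require Import boolp classical_sets reals topology normedtype.

Set Implicit Arguments.
Unset Strict Implicit.
Unset Printing Implicit Defensive.

Import Order.TTheory GRing.Theory Num.Theory.
Import numFieldNormedType.Exports.

Local Open Scope ring_scope.

(* C*-algebras over the complex numbers R[i]; no unit is required. *)
HB.mixin Record isCStarAlgebra (R : realType) A
    & CompleteNormedModule R[i] A := {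
  cmul : A -> A -> A;
  cstar : A -> A;
  cmulA : associative cmul;
  cmulDl : left_distributive cmul +%R;
  cmulDr : right_distributive cmul +%R;
  cscaleAl : forall (k : R[i]) (a b : A), k *: cmul a b = cmul (k *: a) b;
  cscaleAr : forall (k : R[i]) (a b : A), k *: cmul a b = cmul a (k *: b);
  cstarK : involutive cstar;
  cstarD : {morph cstar : a b / a + b};
  cstarZ : forall (k : R[i]) (a : A), cstar (k *: a) = k^* *: cstar a;
  cstarM : forall a b, cstar (cmul a b) = cmul (cstar b) (cstar a);
  cnormM : forall a b, `|cmul a b| <= `|a| * `|b|;
  cnorm_star : forall a, `|cmul (cstar a) a| = `|a| ^+ 2
}.

#[short(type="cstarAlgType")]
HB.structure Definition CStarAlgebra (R : realType) :=
  {A of CompleteNormedModule R[i] A & isCStarAlgebra R A}.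

(* In the unitization of A, quasi_inv a b says that 1 - b is the two-sided
   inverse of 1 - a; hence l - a is invertible there, for l <> 0, exactly when
   l^-1 *: a has a quasi-inverse. *)
Definition quasi_inv (R : realType) (A : cstarAlgType R) (a b : A) :=
  a + b = cmul a b /\ a + b = cmul b a.

(* Positive elements: self-adjoint with spectrum contained in [0, +oo[. The
   order on R[i] makes 0 <= l mean that l is a nonnegative real number. *)
Definition cpos (R : realType) (A : cstarAlgType R) (a : A) :=
  cstar a = a /\
  forall l : R[i], ~~ (0 <= l) -> exists b, quasi_inv (l^-1 *: a) b.

(* Right A-modules with a nondegenerate Hermitian A-valued form, linear in the
   second variable. This is the part of the structure of a Hilbert module on
   which adjointable operators depend. Positivity and completeness are stated
   separately, in isHilbertModule, so that the orthogonal direct sum is an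
   instance by direct computation. *)
HB.mixin Record isFormModule (R : realType) (A : cstarAlgType R) E
    & GRing.Lmodule R[i] E := {
  hact : E -> A -> E;
  hactDl : forall x y a, hact (x + y) a = hact x a + hact y a;
  hactDr : forall x a b, hact x (a + b) = hact x a + hact x b;
  hactA : forall x a b, hact (hact x a) b = hact x (cmul a b);
  hactZl : forall (k : R[i]) x a, hact (k *: x) a = k *: hact x a;
  hactZr : forall (k : R[i]) x a, hact x (k *: a) = k *: hact x a;
  inner : E -> E -> A;
  innerDr : forall x y z, inner x (y + z) = inner x y + inner x z;
  innerZr : forall (k : R[i]) x y, inner x (k *: y) = k *: inner x y;
  inner_act : forall x y a, inner x (hact y a) = cmul (inner x y) a;
  inner_star : forall x y, cstar (inner x y) = inner y x;
  inner_nondeg : forall x, (forall y, inner x y = 0) -> x = 0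
}.

#[short(type="formModType")]
HB.structure Definition FormModule (R : realType) (A : cstarAlgType R) :=
  {E of GRing.Lmodule R[i] E & isFormModule R A E}.

Definition mnorm (R : realType) (A : cstarAlgType R) (E : formModType A)
  (x : E) : R[i] := sqrtC `|inner x x|.

(* Hilbert A-modules: the inner product is positive definite, and E is complete
   for the norm it defines. *)
HB.mixin Record isHilbertModule (R : realType) (A : cstarAlgType R) E
    & FormModule R A E & CompleteNormedModule R[i] E := {
  inner_pos : forall x : E, cpos (inner x x);
  inner_def : forall x : E, inner x x = 0 -> x = 0;
  norm_inner : forall x : E, `|x| = mnorm x
}.

#[short(type="hilbertModType")]
HB.structure Definition HilbertModule (R : realType) (A : cstarAlgType R) :=
  {E of FormModule R A E & CompleteNormedModule R[i] E
      & isHilbertModule R A E}.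

Section InnerTheory.
Variables (R : realType) (A : cstarAlgType R) (E : formModType A).
Implicit Types x y z : E.

Lemma cstar0 : cstar (0 : A) = 0.
Proof. by have := cstarZ 0 (0 : A); rewrite conjC0 !scale0r. Qed.

Lemma innerDl x y z : inner (x + y) z = inner x z + inner y z.
Proof. by rewrite -inner_star innerDr cstarD !inner_star. Qed.

Lemma inner0r x : inner x 0 = 0.
Proof. by have := innerZr 0 x (0 : E); rewrite !scale0r. Qed.

Lemma inner0l x : inner 0 x = 0.
Proof. by rewrite -inner_star inner0r cstar0. Qed.

Lemma innerNr x y : inner x (- y) = - inner x y.
Proof. by rewrite -scaleN1r innerZr scaleN1r. Qed.

Lemma innerNl x y : inner (- x) y = - inner x y.
Proof. by apply/eqP; rewrite -addr_eq0 -innerDl addNr inner0l. Qed.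

Lemma inner_ext x y : (forall z, inner x z = inner y z) -> x = y.
Proof.
move=> xy; apply/eqP; rewrite -subr_eq0; apply/eqP/inner_nondeg => z.
by rewrite innerDl innerNl xy subrr.
Qed.

End InnerTheory.

(* The orthogonal direct sum, with elementwise operations. *)
Definition dsum (R : realType) (A : cstarAlgType R) (H K : formModType A) :
  Type := (H * K)%type.

Section DirectSum.
Variables (R : realType) (A : cstarAlgType R) (H K : formModType A).

HB.instance Definition _ := GRing.Lmodule.copy (dsum H K) (H * K)%type.

Let act (x : dsum H K) (a : A) : dsum H K := (hact x.1 a, hact x.2 a).
Let form (x y : dsum H K) : A := inner x.1 y.1 + inner x.2 y.2.

Let actDl x y a : act (x + y) a = act x a + act y a.
Proof. by rewrite /act /= !hactDl. Qed.
Let actDr x a b : act x (a + b) = act x a + act x b.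
Proof. by rewrite /act /= !hactDr. Qed.
Let actA x a b : act (act x a) b = act x (cmul a b).
Proof. by rewrite /act /= !hactA. Qed.
Let actZl (k : R[i]) x a : act (k *: x) a = k *: act x a.
Proof. by rewrite /act /= !hactZl. Qed.
Let actZr (k : R[i]) x a : act x (k *: a) = k *: act x a.
Proof. by rewrite /act /= !hactZr. Qed.
Let formDr x y z : form x (y + z) = form x y + form x z.
Proof. by rewrite /form /= !innerDr addrACA. Qed.
Let formZr (k : R[i]) x y : form x (k *: y) = k *: form x y.
Proof. by rewrite /form /= !innerZr scalerDr. Qed.
Let form_act x y a : form x (act y a) = cmul (form x y) a.
Proof. by rewrite /form /= !inner_act cmulDl. Qed.
Let form_star x y : cstar (form x y) = form y x.
Proof. by rewrite /form cstarD !inner_star. Qed.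
Let form_nondeg x : (forall y, form x y = 0) -> x = 0.
Proof.
case: x => x1 x2 x0; congr pair; apply: inner_nondeg => y.
  by have := x0 (y, 0); rewrite /form /= inner0r addr0.
by have := x0 (0, y); rewrite /form /= inner0r add0r.
Qed.

HB.instance Definition _ := isFormModule.Build R A (dsum H K)
  actDl actDr actA actZl actZr formDr formZr form_act form_star form_nondeg.

Lemma inner_dsum (x y : dsum H K) :
  inner x y = inner x.1 y.1 + inner x.2 y.2.
Proof. by []. Qed.

End DirectSum.

(* An adjointable operator is bundled with its adjoint, which it determines
   (see adj_ext); linearity and boundedness are consequences. *)
Record adjointable (R : realType) (A : cstarAlgType R) (H K : formModType A) :=
  Adjointable {
    adj_fun :> H -> K;
    adj_adj : K -> H;
    adj_innerE : forall x y, inner (adj_fun x) y = inner x (adj_adj y)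
  }.

Notation "''L' ( H , K )" := (adjointable H K)
  (at level 8, format "''L' ( H ,  K )") : type_scope.

Section Adjointable.
Variables (R : realType) (A : cstarAlgType R).
Implicit Types H K L : formModType A.

Lemma adj_ext H K (S T : 'L(H, K)) : S =1 T -> S = T.
Proof.
case: S T => [f f' ff'] [g g' gg'] /= /funext fg; case: _ / fg in gg' *.
have fg' : f' = g'.
  apply/funext => y; apply: inner_ext => x.
  by rewrite -[LHS]inner_star -[RHS]inner_star -ff' -gg'.
by case: _ / fg' in gg' *; congr Adjointable; apply: Prop_irrelevance.
Qed.

HB.instance Definition _ H K := gen_eqMixin 'L(H, K).
HB.instance Definition _ H K := gen_choiceMixin 'L(H, K).

Fact opzero_subproof H K (x : H) (y : K) : inner (0 : K) y = inner x 0.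
Proof. by rewrite inner0l inner0r. Qed.
Definition opzero H K : 'L(H, K) := Adjointable (@opzero_subproof H K).

Fact opopp_subproof H K (S : 'L(H, K)) x y :
  inner (- S x) y = inner x (- adj_adj S y).
Proof. by rewrite innerNl innerNr adj_innerE. Qed.
Definition opopp H K (S : 'L(H, K)) : 'L(H, K) :=
  Adjointable (opopp_subproof S).

Fact opadd_subproof H K (S T : 'L(H, K)) x y :
  inner (S x + T x) y = inner x (adj_adj S y + adj_adj T y).
Proof. by rewrite innerDl innerDr !adj_innerE. Qed.
Definition opadd H K (S T : 'L(H, K)) : 'L(H, K) :=
  Adjointable (opadd_subproof S T).

Fact opaddA H K : associative (@opadd H K).
Proof. by move=> S T U; apply: adj_ext => x /=; rewrite addrA. Qed.
Fact opaddC H K : commutative (@opadd H K).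
Proof. by move=> S T; apply: adj_ext => x /=; rewrite addrC. Qed.
Fact opadd0 H K : left_id (@opzero H K) (@opadd H K).
Proof. by move=> S; apply: adj_ext => x /=; rewrite add0r. Qed.
Fact opaddN H K : left_inverse (@opzero H K) (@opopp H K) (@opadd H K).
Proof. by move=> S; apply: adj_ext => x /=; rewrite addNr. Qed.

HB.instance Definition _ H K := GRing.isZmodule.Build 'L(H, K)
  (@opaddA H K) (@opaddC H K) (@opadd0 H K) (@opaddN H K).

Fact opid_subproof H (x y : H) : inner (id x) y = inner x (id y).
Proof. by []. Qed.
Definition opid H : 'L(H, H) := Adjointable (@opid_subproof H).

Fact opcomp_subproof H K L (S : 'L(K, L)) (T : 'L(H, K)) x y :
  inner (S (T x)) y = inner x (adj_adj T (adj_adj S y)).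
Proof. by rewrite !adj_innerE. Qed.
Definition opcomp H K L (S : 'L(K, L)) (T : 'L(H, K)) : 'L(H, L) :=
  Adjointable (opcomp_subproof S T).

Fact opadj_subproof H K (S : 'L(H, K)) x y :
  inner (adj_adj S x) y = inner x (S y).
Proof. by rewrite -inner_star -adj_innerE inner_star. Qed.
Definition opadj H K (S : 'L(H, K)) : 'L(K, H) :=
  Adjointable (opadj_subproof S).

End Adjointable.

Arguments opid {R A H}.

Notation "S \oL T" := (opcomp S T)
  (at level 40, left associativity) : ring_scope.
Notation "S ^*L" := (opadj S) (at level 2, format "S ^*L") : ring_scope.

Section Blocks.
Variables (R : realType) (A : cstarAlgType R).
Implicit Types H K : formModType A.

Section BlockOp.
Variables (H1 H2 K1 K2 : formModType A).
Variables (T11 : 'L(H1, K1)) (T12 : 'L(H2, K1)).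
Variables (T21 : 'L(H1, K2)) (T22 : 'L(H2, K2)).

Fact opblock_subproof (x : dsum H1 H2) (y : dsum K1 K2) :
  inner ((T11 x.1 + T12 x.2, T21 x.1 + T22 x.2) : dsum K1 K2) y =
  inner x ((T11^*L y.1 + T21^*L y.2, T12^*L y.1 + T22^*L y.2) : dsum H1 H2).
Proof.
by rewrite !inner_dsum /= !innerDl !innerDr !adj_innerE addrACA.
Qed.

(* The block matrix (T11 T12; T21 T22), acting on column pairs. *)
Definition opblock : 'L(dsum H1 H2, dsum K1 K2) :=
  Adjointable opblock_subproof.

End BlockOp.

Definition opdiag H1 H2 (S : 'L(H1, H1)) (T : 'L(H2, H2)) :
  'L(dsum H1 H2, dsum H1 H2) := opblock S 0 0 T.

Fact opin1_subproof H1 H2 (x : H1) (y : dsum H1 H2) :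
  inner ((x, 0) : dsum H1 H2) y = inner x y.1.
Proof. by rewrite inner_dsum /= inner0l addr0. Qed.
Definition opin1 H1 H2 : 'L(H1, dsum H1 H2) :=
  Adjointable (@opin1_subproof H1 H2).

Fact opin2_subproof H1 H2 (x : H2) (y : dsum H1 H2) :
  inner ((0, x) : dsum H1 H2) y = inner x y.2.
Proof. by rewrite inner_dsum /= inner0l add0r. Qed.
Definition opin2 H1 H2 : 'L(H2, dsum H1 H2) :=
  Adjointable (@opin2_subproof H1 H2).

(* The blocks of an operator; the adjoints of the inclusions are the coordinate
   projections. *)
Section BlockOf.
Variables (H1 H2 K1 K2 : formModType A) (T : 'L(dsum H1 H2, dsum K1 K2)).
Definition blk11 : 'L(H1, K1) := (opin1 K1 K2)^*L \oL T \oL opin1 H1 H2.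
Definition blk12 : 'L(H2, K1) := (opin1 K1 K2)^*L \oL T \oL opin2 H1 H2.
Definition blk21 : 'L(H1, K2) := (opin2 K1 K2)^*L \oL T \oL opin1 H1 H2.
Definition blk22 : 'L(H2, K2) := (opin2 K1 K2)^*L \oL T \oL opin2 H1 H2.
End BlockOf.

End Blocks.

Section WeightedMoorePenrose.
Variables (R : realType) (A : cstarAlgType R).
Implicit Types H K : formModType A.
Local Open Scope classical_set_scope.

Definition is_opinv H (T S : 'L(H, H)) := S \oL T = opid /\ T \oL S = opid.

(* The inverse in L(H), and 0 for an operator which is not invertible. *)
Definition opinv H (T : 'L(H, H)) : 'L(H, H) := xget 0 [set S | is_opinv T S].

Definition oppos H (T : 'L(H, H)) := forall x : H, cpos (inner x (T x)).

Definition opposdef H (T : 'L(H, H)) := oppos T /\ exists S, is_opinv T S.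

(* The range contains every limit point for the norm of the module K. *)
Definition closed_range H K (T : 'L(H, K)) := forall y : K,
  (forall e : R[i], 0 < e -> exists x, mnorm (T x - y) < e) ->
  exists x, T x = y.

Definition is_wMP H K (M : 'L(K, K)) (N : 'L(H, H)) (T : 'L(H, K))
    (X : 'L(K, H)) :=
  [/\ T \oL X \oL T = T, X \oL T \oL X = X,
      (M \oL T \oL X)^*L = M \oL T \oL X &
      (N \oL X \oL T)^*L = N \oL X \oL T].

(* The weighted Moore-Penrose inverse; it is unique when the weights M and N
   are positive definite, and it is 0 by convention when there is none, which
   does not happen for T with closed range. *)
Definition wMP H K (M : 'L(K, K)) (N : 'L(H, H)) (T : 'L(H, K)) : 'L(K, H) :=
  xget 0 [set X | is_wMP M N T X].

Definition schur H1 H2 (T11 : 'L(H1, H1)) (T12 : 'L(H2, H1))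
  (T22 : 'L(H2, H2)) : 'L(H2, H2) := T22 - T12^*L \oL opinv T11 \oL T12.

End WeightedMoorePenrose.

Notation "T ^-1L" := (opinv T) (at level 2, format "T ^-1L") : ring_scope.

(* Main.v *)
Require Import Defs.
From mathcomp Require Import all_boot all_order all_algebra complex.
From mathcomp Require Import boolp classical_sets reals.
From mathcomp Require Import topology normedtype sequences.
From mathcomp Require Import ring lra.

Set Implicit Arguments.
Unset Strict Implicit.
Unset Printing Implicit Defensive.

Import Order.TTheory GRing.Theory Num.Theory.
Import numFieldNormedType.Exports.
Local Open Scope classical_set_scope.
Local Open Scope ring_scope.
Local Notation "x %:C" := (real_complex _ x) (format "x %:C") : ring_scope.

(** Put F = N11^-1 N12 and G = M11^-1 M12, and let U and V be the unipotent
    block matrices with upper right corners F and G. The block LDL factorization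
    [opblock_schur] gives N = U^* diag(N11, S(N)) U and
    M = V^* diag(M11, S(M)) V, and B is V A U^-1. The equations that define a
    weighted Moore-Penrose inverse are invariant under such a change of weights
    ([is_wMP_congr]), and their solution is unique ([is_wMP_unique]), so
    A^dag = U^-1 B^dag V ([wMP_congr]); the four formulas are the blocks of this
    product.

    The factorization rests on the invertibility of N11, the one analytic fact
    of the proof ([opposdef_corner]). Cauchy-Schwarz for the form of N, applied
    to x and N^-1 x, shows that <x, N11 x> is bounded below by a multiple of the
    square of the norm of x ([oppos_inv_lower]; N^-1 has bounded blocks by
    [adjointable_bounded]). The operators N11 + m with m >= 0 are then uniformly
    bounded below and, for large m, invertible, so that the method of continuity
    reaches m = 0 ([coercive_invertible]).

    What this needs from C*-algebras is the norm inequality |a| <= 2 |a + b| for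
    positive a and b ([cpos_norm_le]), where positivity is a condition on the
    spectrum. It follows from the fact that the
    spectrum of a self-adjoint b meets the circle of radius |b|
    ([sa_circle_spectrum]). If it did not, with |b| = 1, the resolvents of b and
    of r b for some r < 1 would be close to each other on the circle, and the
    partial fraction of 1 / (1 - x^2) shows that this closeness passes from
    these elements to their squares; iterated squaring contradicts the
    C*-identity. *)

(** * Linear identities in modules *)

(** An identity between linear combinations of atoms holds as soon as each atom
    has the same coefficient on both sides; the tactic at the end of this part
    reads off the atoms and leaves the coefficient equalities to ring. *)
Section ModuleIdentities.
Variables (K : pzRingType) (V : lmodType K).

Inductive lexp :=
  | LVar of nat | LZero | LAdd of lexp & lexp | LOpp of lexp
  | LScale of K & lexp.

Fixpoint leval (env : seq V) e : V :=
  match e with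
  | LVar i => nth 0 env i
  | LZero => 0
  | LAdd e1 e2 => leval env e1 + leval env e2
  | LOpp e1 => - leval env e1
  | LScale k e1 => k *: leval env e1
  end.

Fixpoint lcoef (i : nat) e : K :=
  match e with
  | LVar j => if Nat.eqb i j then 1 else 0
  | LZero => 0
  | LAdd e1 e2 => lcoef i e1 + lcoef i e2
  | LOpp e1 => - lcoef i e1
  | LScale k e1 => k * lcoef i e1
  end.

Fixpoint same_coefs n e1 e2 : Prop :=
  if n is m.+1 then lcoef m e1 = lcoef m e2 /\ same_coefs m e1 e2 else True.

Lemma leval_coef env e :
  leval env e = \sum_(i < size env) lcoef i e *: nth 0 env i.
Proof.
elim: e => [j| |e1 IH1 e2 IH2|e1 IH1|k e1 IH1] /=.
- have [ji|ij] := ltnP j (size env).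
    rewrite (bigD1 (Ordinal ji)) //= PeanoNat.Nat.eqb_refl scale1r.
    rewrite big1 ?addr0 // => i ij.
    have -> : Nat.eqb i j = false by apply/PeanoNat.Nat.eqb_neq/eqP.
    by rewrite scale0r.
  rewrite nth_default // big1 // => i _.
  have -> : Nat.eqb i j = false.
    by apply/PeanoNat.Nat.eqb_neq => ji; move: (ltn_ord i);
      rewrite ji ltnNge ij.
  by rewrite scale0r.
- by rewrite big1 // => i _; rewrite scale0r.
- by rewrite IH1 IH2 -big_split; apply: eq_bigr => i _; rewrite scalerDl.
- by rewrite IH1 -sumrN; apply: eq_bigr => i _; rewrite scaleNr.
- by rewrite IH1 scaler_sumr; apply: eq_bigr => i _; rewrite scalerA.
Qed.

(** Sufficient only: the atoms may satisfy further linear relations. *)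
Lemma leval_eq env e1 e2 :
  same_coefs (size env) e1 e2 -> leval env e1 = leval env e2.
Proof.
move=> e12; rewrite !leval_coef; apply: eq_bigr => i _; congr (_ *: _).
move: (nat_of_ord i) (ltn_ord i) e12 => {i} i.
elim: (size env) => // n IH; rewrite ltnS leq_eqVlt.
by case/predU1P=> [->|/IH{}IH] [].
Qed.

End ModuleIdentities.

Arguments LVar {K}.
Arguments LZero {K}.

(* The inner match runs constr_eq while a term is being computed; its failure
   selects the next branch. *)
Ltac lmem x l :=
  lazymatch l with
  | nil => constr:(false)
  | cons ?y ?l' =>
    match goal with
    | _ => let _ := match goal with _ => constr_eq x y end in constr:(true)
    | _ => lmem x l'
    end
  end.

Ltac lindex x l :=
  lazymatch l with
  | cons ?y ?l' =>
    match goal with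
    | _ => let _ := match goal with _ => constr_eq x y end in constr:(0%N)
    | _ => let n := lindex x l' in constr:(S n)
    end
  end.

Ltac latoms t l :=
  lazymatch t with
  | GRing.add ?a ?b => let l1 := latoms a l in latoms b l1
  | GRing.opp ?a => latoms a l
  | GRing.zero => l
  | GRing.scale _ ?a => latoms a l
  | _ => let b := lmem t l in
         lazymatch b with true => l | false => constr:(cons t l) end
  end.

Ltac lreify K t l :=
  lazymatch t with
  | GRing.add ?a ?b =>
    let x := lreify K a l in let y := lreify K b l in constr:(@LAdd K x y)
  | GRing.opp ?a => let x := lreify K a l in constr:(@LOpp K x)
  | GRing.zero => constr:(@LZero K)
  | GRing.scale ?k ?a => let x := lreify K a l in constr:(@LScale K k x)
  | _ => let n := lindex t l in constr:(@LVar K n)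
  end.

Ltac lmod_over K :=
  lazymatch goal with
  | |- @eq ?T ?a ?b =>
    let l0 := latoms a (@nil T) in
    let l := latoms b l0 in
    let x := lreify K a l in
    let y := lreify K b l in
    apply: (@leval_eq K _ l x y);
    cbn [same_coefs size lcoef Nat.eqb];
    repeat (split; [|])
  end.

Ltac lmod R :=
  lmod_over (complex R : pzRingType); first [exact: I | ring | idtac].

(** * Real-valued norms and completeness *)
Section RealNorm.
Variables (R : realType) (V : normedModType R[i]).
Implicit Types (x y : V) (k : R[i]) (t : R).

(** The norms of modules over the complex field take their values in that field,
    whose order is partial; their real parts live in a totally ordered field. *)
Definition rnorm x : R := complex.Re `|x|.

Lemma rnormE x : `|x| = (rnorm x)%:C.
Proof. by rewrite /rnorm RRe_real ?normr_real. Qed.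

Lemma rnorm_ge0 x : 0 <= rnorm x.
Proof. by rewrite -lecR -rnormE normr_ge0. Qed.

Lemma rnorm0 : rnorm (0 : V) = 0.
Proof. by rewrite /rnorm normr0. Qed.

Lemma rnorm0_eq0 x : rnorm x = 0 -> x = 0.
Proof. by move=> x0; apply/normr0_eq0; rewrite rnormE x0. Qed.

Lemma rnorm_gt0 x : x != 0 -> 0 < rnorm x.
Proof.
move=> x0; rewrite lt_def rnorm_ge0 andbT; apply: contra_neq x0.
exact: rnorm0_eq0.
Qed.

Lemma rnormN x : rnorm (- x) = rnorm x.
Proof. by rewrite /rnorm normrN. Qed.

Lemma rnormD x y : rnorm (x + y) <= rnorm x + rnorm y.
Proof. by rewrite -lecR rmorphD /= -!rnormE ler_normD. Qed.

Lemma rnormB x y : rnorm (x - y) <= rnorm x + rnorm y.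
Proof. by rewrite -(rnormN y) rnormD. Qed.

Lemma rnormBC x y : rnorm (x - y) = rnorm (y - x).
Proof. by rewrite -rnormN opprB. Qed.

Lemma rnorm_triangle x y : rnorm x <= rnorm (x - y) + rnorm y.
Proof. by have := rnormD (x - y) y; rewrite subrK. Qed.

Lemma rnormZ k x : rnorm (k *: x) = complex.Re `|k| * rnorm x.
Proof.
apply/complexI; rewrite -rnormE normrZ rnormE rmorphM /=.
by rewrite (RRe_real (normr_real k)).
Qed.

Lemma rnormZ1 k x : `|k| = 1 -> rnorm (k *: x) = rnorm x.
Proof. by move=> k1; rewrite rnormZ k1 mul1r. Qed.

Lemma rnormZR t x : rnorm (t%:C *: x) = `|t| * rnorm x.
Proof. by rewrite rnormZ normc_def /= expr0n addr0 sqrtr_sqr. Qed.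

Lemma rnormZR_ge0 t x : 0 <= t -> rnorm (t%:C *: x) = t * rnorm x.
Proof. by move=> t0; rewrite rnormZR ger0_norm. Qed.

End RealNorm.

Section Completeness.
Variables (R : realType) (V : completeNormedModType R[i]).

(** Cantor's intersection principle. Both uses of completeness, the Neumann
    series and the uniform boundedness argument, are instances of it. *)
Lemma nested_balls (u : nat -> V) (r : nat -> R) :
    (forall n, 0 <= r n) ->
    (forall n, rnorm (u n.+1 - u n) + r n.+1 <= r n) ->
    (forall e, 0 < e -> exists n, r n < e) ->
  exists x, forall n, rnorm (x - u n) <= r n.
Proof.
move=> r_ge0 ur r0.
have dist m n : (m <= n)%N -> rnorm (u n - u m) <= r m.
  move=> mn; suff : rnorm (u n - u m) + r n <= r m by have := r_ge0 n; lra.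
  elim: n mn => [|n IH].
    by rewrite leqn0 => /eqP->; rewrite subrr rnorm0 add0r.
  rewrite leq_eqVlt => /predU1P[->|]; first by rewrite subrr rnorm0 add0r.
  rewrite ltnS => /IH; have := ur n.
  have -> : u n.+1 - u m = (u n.+1 - u n) + (u n - u m) by rewrite addrA subrK.
  by have := rnormD (u n.+1 - u n) (u n - u m); lra.
have : cauchy (u @ \oo).
  apply/cauchy_exP => e e0; have [n rn] : exists n, r n < complex.Re e.
    by apply: r0; move: e0; rewrite ltcE => /andP[].
  exists (u n); exists n => // m /= nm; rewrite -ball_normE /=.
  move: e0 rn; rewrite ltcE -normrN opprB rnormE ltcE /= => /andP[-> _] rn.
  exact: le_lt_trans (dist _ _ nm) rn.
move=> /cauchy_cvgP/cvgrPdist_lt; set x := lim _ => ux; exists x => n.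
apply/ler_addgt0Pl => e e0; have [|m _ um] := ux e%:C; first by rewrite ltcR.
have := um (maxn m n) (leq_maxl _ _); rewrite /= rnormE ltcR => xe.
have := dist n (maxn m n) (leq_maxr _ _).
have -> : x - u n = (x - u (maxn m n)) + (u (maxn m n) - u n).
  by rewrite addrA subrK.
by have := rnormD (x - u (maxn m n)) (u (maxn m n) - u n); lra.
Qed.

Lemma exp_small (q e : R) : 0 <= q -> q < 1 -> 0 < e -> exists n, q ^+ n < e.
Proof.
move=> q0 q1 e0; have := @cvg_expr R q; rewrite ger0_norm // => /(_ q1).
move=> /cvgrPdist_lt /(_ e e0)[n _ /(_ n (leqnn _))] /=.
by rewrite sub0r normrN ger0_norm ?exprn_ge0 // => qn; exists n.
Qed.

(** The solution is the limit of the partial sums of the Neumann series. *)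
Lemma neumann (f : V -> V) (q : R) :
    q < 1 -> (forall x y, f (x - y) = f x - f y) ->
    (forall x, rnorm (f x) <= q * rnorm x) ->
  forall y, exists x, x - f x = y.
Proof.
move=> q1 fB fq y.
have [q0|q0] := ltP q 0.
  exists y; have : rnorm (f y) = 0.
    have := fq y; have := rnorm_ge0 y; have := rnorm_ge0 (f y); nra.
  by move=> /rnorm0_eq0->; rewrite subr0.
pose u n := iter n (fun x => y + f x) 0.
pose r n := q ^+ n * (rnorm y / (1 - q)).
have uE n : u n.+1 = y + f (u n) by [].
have uS n : u n.+2 - u n.+1 = f (u n.+1 - u n).
  by rewrite fB (uE n.+1) {2}(uE n) opprD addrACA subrr add0r.
have f0 : f 0 = 0 by have := fB 0 0; rewrite !subrr.
have u0 : u 0%N = 0 by [].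
have du n : rnorm (u n.+1 - u n) <= q ^+ n * rnorm y.
  elim: n => [|n IH]; first by rewrite uE u0 f0 addr0 subr0 mul1r.
  rewrite uS; apply: le_trans (fq _) _.
  by rewrite exprS -mulrA ler_wpM2l.
have r_ge0 n : 0 <= r n.
  by rewrite !mulr_ge0 ?exprn_ge0 ?rnorm_ge0 // invr_ge0; lra.
have r_small e : 0 < e -> exists n, r n < e.
  move=> e0.
  have [|n qn] := exp_small q0 q1 (e := e / (rnorm y / (1 - q) + 1)).
    by rewrite divr_gt0 // ltr_wpDl // divr_ge0 ?rnorm_ge0 //; lra.
  exists n; move: qn; rewrite ltr_pdivlMr; last first.
    by rewrite ltr_wpDl // divr_ge0 ?rnorm_ge0 //; lra.
  have : 0 <= q ^+ n by rewrite exprn_ge0.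
  by rewrite /r; lra.
have [|x xu] := @nested_balls u r r_ge0 _ r_small.
  move=> n; have := du n.
  have -> : r n = q ^+ n * rnorm y + r n.+1.
    by rewrite /r exprS; field; lra.
  lra.
exists x; apply/eqP; rewrite -subr_eq0; apply/eqP/rnorm0_eq0.
apply/eqP; rewrite eq_le rnorm_ge0 andbT; apply/ler_addgt0Pl => e e0.
have [n rn] := r_small (e / 2) ltac:(lra).
have -> : x - f x - y = (x - u n.+1) - f (x - u n).
  by rewrite fB uE; lmod R.
have := rnormB (x - u n.+1) (f (x - u n)).
have := xu n; have := xu n.+1; have := fq (x - u n).
have : r n.+1 <= r n by rewrite /r exprS -mulrA ler_piMl //; [exact: r_ge0|lra].
have := rnorm_ge0 (x - u n); nra.
Qed.
End Completeness.
(** * Self-adjoint elements of a C*-algebra *)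
Section CStarAlgebra.
Variables (R : realType) (A : cstarAlgType R).
Implicit Types (a b c d p q x y z : A) (k l : R[i]).

Lemma cmulZl k a b : cmul (k *: a) b = k *: cmul a b.
Proof. by rewrite cscaleAl. Qed.

Lemma cmulZr k a b : cmul a (k *: b) = k *: cmul a b.
Proof. by rewrite cscaleAr. Qed.

Lemma cmulNl a b : cmul (- a) b = - cmul a b.
Proof. by rewrite -scaleN1r cmulZl scaleN1r. Qed.

Lemma cmulNr a b : cmul a (- b) = - cmul a b.
Proof. by rewrite -scaleN1r cmulZr scaleN1r. Qed.

Definition cmul_lin :=
  (@cmulDl R A, @cmulDr R A, cmulNl, cmulNr, cmulZl, cmulZr).

Lemma cstarN a : cstar (- a) = - cstar a.
Proof. by rewrite -scaleN1r cstarZ rmorphN rmorph1 scaleN1r. Qed.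

Lemma cstarB a b : cstar (a - b) = cstar a - cstar b.
Proof. by rewrite cstarD cstarN. Qed.

Lemma cstar_realZ (t : R) a : cstar (t%:C *: a) = t%:C *: cstar a.
Proof.
by rewrite cstarZ; congr (_ *: _); rewrite conj_Creal // complex_real.
Qed.

Lemma rnormM a b : rnorm (cmul a b) <= rnorm a * rnorm b.
Proof. by rewrite -lecR rmorphM /= -!rnormE cnormM. Qed.

Lemma rnorm_starM a : rnorm (cmul (cstar a) a) = rnorm a ^+ 2.
Proof. by apply/complexI; rewrite rmorphXn /= -!rnormE cnorm_star. Qed.

Lemma rnorm_star a : rnorm (cstar a) = rnorm a.
Proof.
suff le b : rnorm b <= rnorm (cstar b).
  by apply/le_anti; rewrite le andbT -{2}(cstarK a) le.
have := rnorm_starM b; have := rnormM (cstar b) b.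
have := rnorm_ge0 b; have := rnorm_ge0 (cstar b); nra.
Qed.

Lemma rnorm_sa_sq b : cstar b = b -> rnorm (cmul b b) = rnorm b ^+ 2.
Proof. by move=> bs; rewrite -rnorm_starM bs. Qed.

(** Both elements have the same image under a |-> cmul (cstar a) a, because
    b commutes with the scalars l and l^*; the C*-identity concludes. *)
Lemma sa_sub_conj b l y : cstar b = b ->
  rnorm (cmul b y - l *: y) = rnorm (cmul b y - l^* *: y).
Proof.
move=> bs; apply: (pexpIrn (n := 2)) => //; rewrite ?nnegrE ?rnorm_ge0 //.
rewrite -!rnorm_starM; congr rnorm.
rewrite !cstarB !cstarZ !cstarM bs !cmul_lin !cmulA conjCK.
lmod R.
Qed.

(** Nonreal numbers are uniformly far from the spectrum of b: the elements
    b y - l y and b y - l^* y have equal norms, and their difference is y scaled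
    by 2 i (Im l). *)
Lemma sa_bounded_below_nonreal b l y : cstar b = b ->
  `|complex.Im l| * rnorm y <= rnorm (cmul b y - l *: y).
Proof.
move=> bs; have := rnormB (cmul b y - l^* *: y) (cmul b y - l *: y).
rewrite -sa_sub_conj //.
have -> : cmul b y - l^* *: y - (cmul b y - l *: y) = (l - l^*) *: y by lmod R.
rewrite rnormZ; case: l => u v.
have -> : Complex u v - (Complex u v)^* = Complex 0 (v + v).
  by congr Complex => /=; ring.
rewrite normc_def /= expr0n add0r sqrtr_sqr -mulr2n normrMn.
lra.
Qed.

(** In the unitization, 1 - p is a right inverse of 1 - a. *)
Definition rquasi a p := a + p = cmul a p.

Lemma rquasi_neumann a : rnorm a < 1 -> exists p, rquasi a p.
Proof.
move=> a1; have [||p pa] := @neumann _ A (cmul a) (rnorm a) a1 _ _ (- a).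
- by move=> x y; rewrite !cmul_lin.
- by move=> x; apply: rnormM.
by exists p; rewrite /rquasi -{1}[a]opprK -pa opprB subrK.
Qed.

End CStarAlgebra.
(** * The spectrum of a self-adjoint element reaches its norm *)
Section SpectralRadius.
Variables (R : realType) (A : cstarAlgType R).
Implicit Types (a b c d p q x y z : A) (k l : R[i]).

(** Taking adjoints turns the right quasi-inverse p into the left quasi-inverse
    cstar p, and (1 - cstar p) (1 - b) y = y. *)
Lemma sa_rquasi_bounded_below b p : cstar b = b -> rquasi b p ->
  forall y, rnorm y <= (1 + rnorm p) * rnorm (y - cmul b y).
Proof.
move=> bs bp y.
have pb : cmul (cstar p) b = b + cstar p.
  by rewrite -{1}bs -cstarM -bp cstarD bs.
have {1}-> : y = (y - cmul b y) - cmul (cstar p) (y - cmul b y).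
  by rewrite cmulDr cmulNr cmulA pb cmulDl; lmod R.
apply: le_trans (rnormB _ _) _; rewrite mulrDl mul1r lerD2l.
by rewrite -[rnorm p]rnorm_star rnormM.
Qed.

(** On the right half of the unit circle the distance to 1 is controlled by the
    imaginary part: |1 - (u + i v)|^2 = 2 (1 - u) <= 2 (1 - u^2) = 2 v^2. *)
Lemma norm1_sub1 (u v : R) : `|Complex u v| = 1 -> 0 <= u ->
  complex.Re `|1 - Complex u v| <= 2 * `|v|.
Proof.
move=> uv u0; have {uv} uv : u ^+ 2 + v ^+ 2 = 1.
  by have := add_Re2_Im2 (Complex u v); rewrite uv expr1n => /complexI.
rewrite normc_def /= sub0r sqrrN.
have u1 : u <= 1 by nra.
have -> : 2 * `|v| = Num.sqrt ((2 * v) ^+ 2).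
  by rewrite sqrtr_sqr normrM ger0_norm.
by rewrite ler_sqrt; nra.
Qed.

(** At a point k of the right half circle, 1 - k b is bounded below by |Im k|,
    because k is nonreal, and by d - 2 |Im k|, because k is close to 1; one of
    the two numbers is at least d / 3. *)
Lemma sa_circle_half b (d : R) : cstar b = b -> rnorm b <= 1 ->
    (forall y, d * rnorm y <= rnorm (y - cmul b y)) ->
  forall k y, `|k| = 1 -> 0 <= complex.Re k ->
  d / 3 * rnorm y <= rnorm (y - k *: cmul b y).
Proof.
move=> bs b1 bd k y k1 k0.
have le1 : `|complex.Im k| * rnorm y <= rnorm (y - k *: cmul b y).
  rewrite -(rnormZ1 (y - _) (k := k^*)); last by rewrite norm_conjC.
  have -> : k^* *: (y - k *: cmul b y) = - (cmul b y - k^* *: y).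
    have kk : k^* * k = 1 by rewrite mulrC -normCK k1 expr1n.
    by rewrite scalerBr scalerA kk scale1r opprB.
  rewrite rnormN; have := sa_bounded_below_nonreal (k^*) y bs.
  by case: {k1 k0} k => u v /=; rewrite normrN.
have le2 : d * rnorm y <=
    rnorm (y - k *: cmul b y) + 2 * `|complex.Im k| * rnorm y.
  apply: le_trans (bd y) _.
  have -> : y - cmul b y = (y - k *: cmul b y) - (1 - k) *: cmul b y by lmod R.
  apply: le_trans (rnormB _ _) _; rewrite lerD2l rnormZ.
  have := rnormM b y; have := rnorm_ge0 y; have := rnorm_ge0 (cmul b y).
  have : complex.Re `|1 - k| <= 2 * `|complex.Im k|.
    by move: k1 k0; case: {le1} k => u v k1 k0; apply: norm1_sub1.
  have : 0 <= complex.Re `|1 - k| by rewrite normc_def /= sqrtr_ge0.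
  by move=> *; apply: ler_pM => //; nra.
by lra.
Qed.

(** The constant is uniform on the circle and depends only on the quasi-inverses
    at 1 and -1; the left half circle is the right one for - b. *)
Lemma sa_circle_bounded_below b : cstar b = b -> rnorm b <= 1 ->
    (forall k, `|k| = 1 -> exists p, rquasi (k *: b) p) ->
  exists2 K, 1 <= K & forall k y, `|k| = 1 ->
    rnorm y <= K * rnorm (y - k *: cmul b y).
Proof.
move=> bs b1 bq; have [p bp] := bq 1 (normr1 _).
have [q bq'] := bq (- 1) (normrN1 _).
rewrite scale1r in bp; rewrite scaleN1r in bq'.
pose C := 1 + rnorm p + rnorm q.
have C1 : 1 <= C by have := rnorm_ge0 p; have := rnorm_ge0 q; rewrite /C; lra.
have half c r : cstar c = c -> rnorm c <= 1 -> rquasi c r -> rnorm r <= C - 1 ->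
    forall k y, `|k| = 1 -> 0 <= complex.Re k ->
    rnorm y <= 3 * C * rnorm (y - k *: cmul c y).
  move=> cs c1 cr rC k y k1 k0.
  have := @sa_circle_half c C^-1 cs c1 _ k y k1 k0.
  rewrite mulrAC -mulrA -ler_pdivlMl ?invr_gt0; last by lra.
  rewrite invrK ler_pdivrMr // => le; apply: (le_trans (le _)); last by lra.
  move=> z; rewrite ler_pdivrMl; last by lra.
  apply: le_trans (sa_rquasi_bounded_below cs cr z) _.
  by rewrite ler_wpM2r ?rnorm_ge0 //; lra.
exists (3 * C) => [|k y k1]; first by lra.
have [k0|k0] := leP 0 (complex.Re k).
  by apply: half bp _ _ _ k1 k0 => //; have := rnorm_ge0 q; rewrite /C; lra.
have -> : k *: cmul b y = (- k) *: cmul (- b) y by rewrite cmulNl; lmod R.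
apply: half bq' _ _ _ _ _ => //; rewrite ?cstarN ?bs ?rnormN ?normrN //.
  by have := rnorm_ge0 p; rewrite /C; lra.
by case: k k0 {k1} => u v /=; lra.
Qed.

(** The resolvents of x and y exist on the whole unit circle and are uniformly
    D-close there. *)
Definition circle_close (D : R) x y := forall k, `|k| = 1 ->
  exists p q, [/\ rquasi (k *: x) p, rquasi (k *: y) q & rnorm (p - q) <= D].

(** Partial fractions:
    (1 - x^2)^-1 = ((1 - x)^-1 + (1 + x)^-1) / 2. *)
Lemma rquasi_sq x p q : rquasi x p -> rquasi (- x) q ->
  rquasi (cmul x x) (2^-1 *: (p + q)).
Proof.
rewrite /rquasi cmulNl => xp xq.
have xq' : cmul x q = x - q by rewrite -[LHS]opprK -xq opprD opprK.
rewrite cmulZr cmulDr -!cmulA xq' -xp !cmul_lin xq' -xp.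
lmod R; by field.
Qed.

(** The distance D does not grow under squaring, since the resolvent of the
    square at k is the mean of the resolvents at the two square roots of k. *)
Lemma circle_close_sq D x y :
  circle_close D x y -> circle_close D (cmul x x) (cmul y y).
Proof.
move=> xyD k k1; pose l := sqrtC k.
have l1 : `|l| = 1.
  by apply: (pexpIrn (n := 2)); rewrite ?nnegrE // -normrX sqrtCK expr1n.
have sq z : k *: cmul z z = cmul (l *: z) (l *: z).
  by rewrite cmulZl cmulZr scalerA -expr2 sqrtCK.
have [p [q [xp yq pq]]] := xyD l l1.
have [|p' [q' [xp' yq' pq']]] := xyD (- l); first by rewrite normrN.
rewrite !scaleNr in xp' yq'.
exists (2^-1 *: (p + p')), (2^-1 *: (q + q')); rewrite !sq.
split; [exact: rquasi_sq|exact: rquasi_sq|].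
have -> : 2^-1 *: (p + p') - 2^-1 *: (q + q')
    = (2^-1)%:C *: ((p - q) + (p' - q')).
  rewrite fmorphV rmorph_nat; lmod R.
rewrite rnormZR_ge0 //; have := rnormD (p - q) (p' - q'); lra.
Qed.

Definition sqiter n x := iter n (fun z => cmul z z) x.

Lemma circle_close_sqiter D x y n :
  circle_close D x y -> circle_close D (sqiter n x) (sqiter n y).
Proof. by move=> xy; elim: n => //= n; apply: circle_close_sq. Qed.

Lemma sqiter_sa b n : cstar b = b -> rnorm b = 1 ->
  cstar (sqiter n b) = sqiter n b /\ rnorm (sqiter n b) = 1.
Proof.
move=> bs b1; elim: n => //= n [IH1 IH2].
by rewrite cstarM IH1 rnorm_sa_sq // IH2 expr1n.
Qed.

Lemma rnorm_sqiter y (r : R) n : 0 <= r < 1 -> rnorm y <= r ->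
  rnorm (sqiter n y) <= r ^+ n.
Proof.
move=> /andP[r0 r1] yr.
suff le : rnorm (sqiter n y) <= r ^+ (2 ^ n).
  apply: le_trans le _.
  by apply: ler_wiXn2l (ltnW (ltn_expl _ _)); rewrite // ltW.
elim: n => //= n IH; apply: le_trans (rnormM _ _) _.
by rewrite expnS mul2n -addnn exprD ler_pM ?rnorm_ge0.
Qed.

(** The resolvent of b is uniformly continuous in the radial direction, by the
    lower bound on the circle. With K that bound, r = 1 - 1 / (8 K (1 + 2 K)) is
    close enough to 1. *)
Lemma sa_circle_close b : cstar b = b -> rnorm b = 1 ->
    (forall k, `|k| = 1 -> exists p, rquasi (k *: b) p) ->
  exists2 r : R, 0 <= r < 1 & circle_close (1 / 8) b (r%:C *: b).
Proof.
move=> bs b1 bq; have [|K K1 bK] := sa_circle_bounded_below bs _ bq.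
  by rewrite b1.
pose e : R := (8 * K * (1 + 2 * K))^-1.
have eK : e * (8 * K * (1 + 2 * K)) = 1 by rewrite mulVf // gt_eqF //; nra.
have e0 : 0 < e by rewrite invr_gt0; nra.
have eK' : e * 8 * K * 3 <= 1 by nra.
exists (1 - e) => [|k k1]; first by nra.
have [p kp] := bq k k1.
have [|q kq] := @rquasi_neumann _ _ (k *: ((1 - e)%:C *: b)).
  by rewrite rnormZ1 // rnormZR_ge0 ?b1; nra.
exists p, q; split=> //.
have bz z : rnorm (cmul b z) <= rnorm z.
  by apply: le_trans (rnormM _ _) _; rewrite b1 mul1r.
have eC : (1 - e)%:C = 1 - e%:C by rewrite rmorphB.
rewrite /rquasi eC !cmulZl in kp kq.
have q2K : rnorm q <= 2 * K.
  have := bK k q k1.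
  have -> : q - k *: cmul b q =
      - ((1 - e)%:C *: (k *: b)) - e%:C *: (k *: cmul b q).
    rewrite eC; apply: (addrI (k *: ((1 - e%:C) *: b))).
    rewrite addrA kq; lmod R.
  have := rnormB (- ((1 - e)%:C *: (k *: b))) (e%:C *: (k *: cmul b q)).
  rewrite rnormN !rnormZR_ge0 ?rnormZ1 //; try by clear kp kq; nra.
  rewrite b1; have := bz q; have := rnorm_ge0 q.
  move: (rnorm (cmul b q)) (rnorm (_ - _)) (rnorm q) => u v w.
  clear -K1 eK' e0 => w0 uw vu wv.
  have : K * v <= K * (1 + e * w) by rewrite ler_wpM2l; nra.
  have : (e * K) * w <= 1 / 24 * w by rewrite ler_wpM2r; lra.
  nra.
have := bK k (p - q) k1.
have -> : p - q - k *: cmul b (p - q)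
    = - (e%:C *: (k *: b)) + e%:C *: (k *: cmul b q).
  rewrite cmulDr cmulNr; apply: (addrI (k *: b)).
  have -> : k *: b + (p - q - k *: (cmul b p - cmul b q))
     = (k *: b + p) - q - k *: (cmul b p - cmul b q) by lmod R.
  rewrite kp; apply: (addrI (k *: ((1 - e%:C) *: b))).
  have -> : k *: ((1 - e%:C) *: b)
      + (k *: cmul b p - q - k *: (cmul b p - cmul b q))
    = k *: ((1 - e%:C) *: b) *+ 2 - (k *: ((1 - e%:C) *: b) + q)
      + k *: cmul b q.
    rewrite mulr2n; lmod R.
  rewrite kq mulr2n; lmod R.
have := rnormD (- (e%:C *: (k *: b))) (e%:C *: (k *: cmul b q)).
rewrite rnormN !rnormZR_ge0 ?rnormZ1 //; try by clear kp kq; nra.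
rewrite b1; have := bz q; have := rnorm_ge0 q; move: q2K.
move: (rnorm (cmul b q)) (rnorm (_ + _)) (rnorm q) (rnorm (p - q)) => u v w z.
clear -K1 eK e0 => w2K w0 uw vu zv.
have : K * v <= K * (e * (1 + 2 * K)) by rewrite ler_wpM2l; nra.
lra.
Qed.

(** If the unit circle avoided the spectrum of b, the resolvents of b^(2^n) and
    of (r b)^(2^n) at 1 would be 1/8-close for every n. But the first power has
    norm 1, by the C*-identity, and the second tends to 0. *)
Lemma sa_circle_spectrum b : cstar b = b -> rnorm b = 1 ->
  ~ forall k, `|k| = 1 -> exists p, rquasi (k *: b) p.
Proof.
move=> bs b1 bq; have [r r01 close] := sa_circle_close bs b1 bq.
have /andP[r0 r1] := r01.
have [|n rn] := @exp_small _ r (1 / 5) r0 r1; first by lra.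
have [p [q []]] := circle_close_sqiter n close (normr1 _).
have [_ x1] := sqiter_sa n bs b1; move: x1; rewrite !scale1r.
have : rnorm (sqiter n (r%:C *: b)) <= 1 / 5.
  apply: le_trans (ltW rn); apply: rnorm_sqiter => //.
  by rewrite rnormZR_ge0 ?b1 ?mulr1.
move: (sqiter n b) (sqiter n _) => x y y5 x1 xp yq pq.
have := rnormB (cmul x p) p; rewrite -{1}xp addrK x1.
have := rnormM x p; rewrite x1.
have := rnormB (cmul y q) y; rewrite -{1}yq addrAC subrr add0r.
have := rnormM y q; have := rnorm_triangle p q.
have := rnorm_ge0 q; nra.
Qed.

End SpectralRadius.
(** * Positive elements *)
Section PositiveElements.
Variables (R : realType) (A : cstarAlgType R).
Implicit Types (a b c d p q x y z : A) (k l : R[i]).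

(** The previous lemma, freed of the normalization. *)
Lemma sa_spectrum b : cstar b = b -> 0 < rnorm b ->
  ~ forall l, `|l| = (rnorm b)%:C -> exists p, rquasi (l^-1 *: b) p.
Proof.
move=> bs b0 bq; pose r := rnorm b.
have rV : r * r^-1 = 1 by rewrite mulfV // gt_eqF.
apply: (@sa_circle_spectrum _ _ ((r^-1)%:C *: b)).
- by rewrite cstar_realZ bs.
- by rewrite rnormZR_ge0 ?invr_ge0 ?rnorm_ge0 // mulrC.
move=> k k1; have [|p kp] := bq (r%:C * k^-1).
  by rewrite normrM normfV k1 invr1 mulr1 ger0_norm // ler0c rnorm_ge0.
exists p; move: kp; rewrite invfM invrK scalerA mulrC.
by rewrite -fmorphV.
Qed.

Lemma cpos_rquasi b l : cpos b -> ~~ (0 <= l) -> exists p, rquasi (l^-1 *: b) p.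
Proof. by move=> [_ bl] /bl[p [bp _]]; exists p. Qed.

(** The hypotheses say that d = b (k + b)^-1 and (k + b) z = 0. *)
Lemma resolvent_cancel b d z (k : R[i]) : k != 0 ->
  cmul d b = b - k *: d -> cmul b z = - (k *: z) -> z = 0.
Proof.
move=> k0 db bz; have := cmulA d b z; rewrite db bz !cmul_lin bz => /eqP.
rewrite -subr_eq0.
have -> : - (k *: cmul d z) - (- (k *: z) - k *: cmul d z) = k *: z by lmod R.
by rewrite scaler_eq0 (negPf k0) => /eqP.
Qed.

(** The element d = b (m + b)^-1 belongs to the algebra itself, and its spectrum
    is contained in [0, 1[, because t - d is invertible when t m / (1 - t) is
    outside the spectrum of b; as d is self-adjoint, its norm is at most 1. *)
Lemma cpos_resolvent b (m : R) : cpos b -> 0 < m -> exists d,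
  [/\ cmul b d = b - m%:C *: d, cmul d b = b - m%:C *: d & rnorm d <= 1].
Proof.
move=> b0 m0; have mC : m%:C != 0 :> R[i].
  by rewrite (inj_eq (@complexI R) m 0) gt_eqF.
have [bs bl] := b0; have [|d] := bl (- m%:C).
  by rewrite oppr_ge0 lt_geF // ltcR.
have mK z : m%:C *: ((- m%:C)^-1 *: z) = - z.
  by rewrite scalerA invrN mulrN mulfV // scaleN1r.
rewrite /quasi_inv !cmul_lin.
move=> -[/(congr1 ( *:%R m%:C)) bd /(congr1 ( *:%R m%:C)) db].
rewrite scalerDr !mK in bd db.
have {}bd : cmul b d = b - m%:C *: d by rewrite -[LHS]opprK -bd; lmod R.
have {}db : cmul d b = b - m%:C *: d by rewrite -[LHS]opprK -db; lmod R.
exists d; split=> //.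
have ds : cstar d = d.
  apply/esym/eqP; rewrite -subr_eq0; apply/eqP/(resolvent_cancel mC db).
  have : cmul b (cstar d) = b - m%:C *: cstar d.
    by rewrite -{1}bs -cstarM db cstarB cstar_realZ bs.
  by rewrite cmulDr cmulNr bd => ->; lmod R.
rewrite leNgt; apply/negP => d1; apply: (sa_spectrum ds); first by lra.
move=> t td; have t1 : 1 < `|t| by rewrite td ltcR.
have t_neq1 : t != 1 by apply: contraTneq t1 => ->; rewrite normr1 ltxx.
have t_neq0 : t != 0 by apply: contraTneq t1 => ->; rewrite normr0 ltr10.
have t1_neq0 : 1 - t != 0 by rewrite subr_eq0 eq_sym.
pose l := t * m%:C / (1 - t).
have l_neq0 : l != 0 by rewrite !mulf_neq0 ?invr_eq0.
have l_nge0 : ~~ (0 <= l).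
  apply/negP => l0; have mC0 : 0 < m%:C by rewrite ltcR.
  have : t * (m%:C + l) = l by rewrite /l; clear -t1_neq0; field.
  have ml0 : 0 <= m%:C + l by rewrite addr_ge0 // ltW.
  move=> /(congr1 Num.norm).
  rewrite normrM (ger0_norm ml0) (ger0_norm l0) => tl.
  have : m%:C + l <= l.
    by rewrite -{2}tl ler_peMl // ltW.
  by rewrite gerDr => /(lt_le_trans mC0); rewrite ltxx.
(* (t - d)^-1 is proportional to (m + b) (b - l)^-1; below, its quasi-inverse is
   expressed with the quasi-inverse e of b / l. *)
have [e] := cpos_rquasi b0 l_nge0.
rewrite /rquasi cmulZl => /(congr1 ( *:%R l)).
rewrite scalerDr !scalerA mulfV // !scale1r => be.
exists ((1 - t)^-1 *: e); rewrite /rquasi cmulZl cmulZr.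
have de : cmul d e = t *: e + (1 - t) *: d.
  apply/eqP; rewrite -subr_eq0; apply/eqP/(resolvent_cancel mC db).
  rewrite !cmul_lin cmulA bd !cmul_lin -be.
  by lmod R; rewrite /l; field.
by rewrite de; lmod R; field; rewrite ?t_neq0 ?t1_neq0.
Qed.

(** If rnorm a = r > 2 rnorm (a + b), then r - a = (r + b) - (a + b) is a small
    perturbation of r + b: it equals (r + b) (1 - e) with
    e = (r + b)^-1 (a + b) of norm less than 1. So r is outside the spectrum
    of a, and no other point of the circle of radius r is in it. The constant 2,
    instead of the sharp 1, is harmless for invertibility questions. *)
Lemma cpos_norm_le a b : cpos a -> cpos b -> rnorm a <= 2 * rnorm (a + b).
Proof.
move=> a0 b0; rewrite leNgt; apply/negP => ab; have [as_ _] := a0.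
have r0 : 0 < rnorm a by have := rnorm_ge0 (a + b); lra.
apply: (sa_spectrum as_ r0) => l la.
have [l0|/(cpos_rquasi a0)//] := boolP (0 <= l).
have {l0 la}-> : l = (rnorm a)%:C by rewrite -la ger0_norm.
move: (rnorm a) r0 ab => r r0 ab.
have rC : r%:C != 0 :> R[i] by rewrite (inj_eq (@complexI R) r 0) gt_eqF.
have [d [bd db d1]] := cpos_resolvent b0 r0.
have [c cE] : exists c, a + b = c by exists (a + b).
pose e := (r^-1)%:C *: (c - cmul d c).
have rVC : (r^-1)%:C = r%:C^-1 by rewrite fmorphV.
have rV0 : 0 < r^-1 by rewrite invr_gt0.
have [|f ef] := @rquasi_neumann _ _ e.
  rewrite /e rnormZR_ge0 ?ltW // mulrC ltr_pdivrMr // mul1r.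
  have := rnormB c (cmul d c); have := rnormM d c; have := rnorm_ge0 c.
  rewrite cE in ab; nra.
have bre : r%:C *: e + cmul b e = c.
  by rewrite /e rVC !cmul_lin cmulA bd !cmul_lin; lmod R; field.
have caf : cmul c f = c + r%:C *: f + cmul b f.
  have := congr1 (fun z => r%:C *: z + cmul b z) ef.
  rewrite cmulDr cmulA -cmulZl -cmulDl bre => <-.
  have -> : r%:C *: (e + f) + (cmul b e + cmul b f)
    = (r%:C *: e + cmul b e) + r%:C *: f + cmul b f by lmod R.
  by rewrite bre.
exists (f + d - cmul f d); rewrite /rquasi cmulZl.
have -> : a = c - b by rewrite -cE addrK.
have -> : cmul (c - b) (f + d - cmul f d) =
    r%:C *: (f + d - cmul f d) + (c - b).
  by rewrite !cmul_lin !cmulA caf bd !cmul_lin; lmod R.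
by lmod R; field.
Qed.

End PositiveElements.
(** * Adjointable operators and positive forms *)
Section AdjointableOperators.
Variables (R : realType) (A : cstarAlgType R).

Lemma inner_extr (E : formModType A) (x y : E) :
  (forall z, inner z x = inner z y) -> x = y.
Proof. by move=> xy; apply: inner_ext => z; rewrite -!(inner_star z) xy. Qed.

Lemma innerZl (E : formModType A) k (x y : E) :
  inner (k *: x) y = k^* *: inner x y.
Proof. by rewrite -inner_star innerZr cstarZ inner_star. Qed.

Section Linearity.
Variables (H K : formModType A) (T : 'L(H, K)).
Implicit Types x y : H.

Lemma adj_funD x y : T (x + y) = T x + T y.
Proof. by apply: inner_ext => z; rewrite innerDl !adj_innerE innerDl. Qed.

Lemma adj_funZ k x : T (k *: x) = k *: T x.
Proof. by apply: inner_ext => z; rewrite innerZl !adj_innerE innerZl. Qed.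

Lemma adj_funN x : T (- x) = - T x.
Proof. by rewrite -scaleN1r adj_funZ scaleN1r. Qed.

Lemma adj_funB x y : T (x - y) = T x - T y.
Proof. by rewrite adj_funD adj_funN. Qed.

Lemma adj_fun0 : T 0 = 0.
Proof. by rewrite -(subrr 0) adj_funB !subrr. Qed.

Lemma inner_opadj (x : K) (y : H) : inner x (T y) = inner (T^*L x) y.
Proof. by rewrite -inner_star adj_innerE inner_star. Qed.

End Linearity.

Section PositiveForms.
Variables (E : formModType A) (T : 'L(E, E)).
Hypothesis T0 : oppos T.
Implicit Types x y : E.

Let iC : R[i] := Complex 0 1.

Let iCJ : iC^* = - iC.
Proof. by congr Complex; rewrite oppr0. Qed.

Let iC2 : iC * iC = -1.
Proof. by rewrite -expr2 sqr_i. Qed.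

(** Polarization of the self-adjoint values inner x (T x). *)
Lemma oppos_selfadj : T^*L = T.
Proof.
pose Q x y := inner (T x) y - inner x (T y).
have Qxx x : Q x x = 0.
  by have [xs _] := T0 x; rewrite /Q -xs inner_star subrr.
have Qsym x y : Q x y + Q y x = 0.
  have := Qxx (x + y); rewrite /Q !adj_funD !innerDl !innerDr => QD.
  have := Qxx x; have := Qxx y; rewrite /Q => /eqP yy /eqP xx.
  rewrite subr_eq0 in xx; rewrite subr_eq0 in yy.
  rewrite (eqP xx) (eqP yy) in QD; rewrite -QD; lmod R.
have Qi x y : Q x (iC *: y) + Q (iC *: y) x = iC *: (Q x y - Q y x).
  by rewrite /Q !adj_funZ !innerZr !innerZl iCJ; lmod R.
have Q0 x y : Q x y = 0.
  have := Qi x y; rewrite Qsym => /esym/(congr1 ( *:%R (- iC))).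
  rewrite scaler0 scalerA mulNr iC2 opprK scale1r => Qxy.
  have /(congr1 ( *:%R 2^-1)) : 2 *: Q x y = 0.
    by rewrite -Qxy -[LHS]subr0 -(Qsym x y); lmod R.
  by rewrite scaler0 scalerA mulVf ?scale1r // pnatr_eq0.
apply: adj_ext => x; apply: inner_extr => y /=.
by rewrite -adj_innerE; apply/eqP; rewrite -subr_eq0; apply/eqP/Q0.
Qed.

(** An additive and non-sharp form of the Cauchy-Schwarz inequality. The values
    of the form at x + y and x - y are positive with sum 2 (<x,Tx> + <y,Ty>), so
    each is bounded by that sum; polarization recovers <x,Ty>. *)
Lemma oppos_cauchy_schwarz x y :
  rnorm (inner x (T y)) <= 4 * (rnorm (inner x (T x)) + rnorm (inner y (T y))).
Proof.
have re u v : rnorm (inner u (T v) + inner v (T u))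
    <= 4 * (rnorm (inner u (T u)) + rnorm (inner v (T v))).
  pose sp := inner (u + v) (T (u + v)); pose sm := inner (u - v) (T (u - v)).
  have spm : sp + sm = 2%:C *: (inner u (T u) + inner v (T v)).
    rewrite /sp /sm !(adj_funB, adj_funD) !(innerDl, innerDr, innerNl, innerNr).
    by rewrite rmorph_nat; lmod R.
  have smp : sm + sp = 2%:C *: (inner u (T u) + inner v (T v)).
    by rewrite addrC.
  have := cpos_norm_le (T0 (u + v)) (T0 (u - v)).
  have := cpos_norm_le (T0 (u - v)) (T0 (u + v)).
  rewrite -/sp -/sm spm smp rnormZR_ge0 //.
  have -> : inner u (T v) + inner v (T u) = (2^-1)%:C *: (sp - sm).
    rewrite /sp /sm !(adj_funB, adj_funD) !(innerDl, innerDr, innerNl, innerNr).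
    by rewrite fmorphV rmorph_nat; lmod R; field.
  rewrite rnormZR_ge0 ?invr_ge0 //; have := rnormB sp sm.
  have := rnormD (inner u (T u)) (inner v (T v)); lra.
have := re x y; have := re x (iC *: y).
rewrite !adj_funZ !innerZr !innerZl scalerA iCJ mulrN iC2 opprK scale1r.
have -> : iC *: inner x (T y) + - iC *: inner y (T x)
  = iC *: (inner x (T y) - inner y (T x)) by lmod R.
rewrite rnormZ1; last by rewrite normc_def /= expr0n expr1n add0r sqrtr1.
have {3}-> : inner x (T y) = (2^-1)%:C *: ((inner x (T y) + inner y (T x))
   + (inner x (T y) - inner y (T x))).
  by rewrite fmorphV rmorph_nat; lmod R; field.
rewrite rnormZR_ge0 ?invr_ge0 //.
have := rnormD (inner x (T y) + inner y (T x))
  (inner x (T y) - inner y (T x)).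
lra.
Qed.

End PositiveForms.
End AdjointableOperators.
(** * Bounded operators on Hilbert modules *)
Section HilbertModules.
Variables (R : realType) (A : cstarAlgType R).

Section Norm.
Variable E : hilbertModType A.
Implicit Types x y : E.

Lemma rnorm_inner x : rnorm (inner x x) = rnorm x ^+ 2.
Proof.
apply/complexI; rewrite rmorphXn /= -!rnormE norm_inner /mnorm.
by rewrite sqrtCK.
Qed.

Lemma hilbert_cauchy_schwarz x y : rnorm (inner x y) <= 8 * rnorm x * rnorm y.
Proof.
have [->|x0] := eqVneq x 0; first by rewrite inner0l !rnorm0 mulr0 mul0r.
have [->|y0] := eqVneq y 0; first by rewrite inner0r !rnorm0 mulr0.
have X0 := rnorm_gt0 x0; have Y0 := rnorm_gt0 y0.
have id0 : oppos (@opid R A E) by move=> z; apply: inner_pos.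
have := oppos_cauchy_schwarz id0 ((rnorm x)^-1%:C *: x) ((rnorm y)^-1%:C *: y).
rewrite /= !rnorm_inner innerZr innerZl conj_Creal ?complex_real //.
rewrite !rnormZR_ge0 ?invr_ge0 ?rnorm_ge0 // !mulVf ?gt_eqF // expr1n.
rewrite mulrCA mulrA -[X in _ * X]mul1r => le.
have : rnorm x * rnorm y * ((rnorm x)^-1 * (rnorm y)^-1 * rnorm (inner x y))
    <= rnorm x * rnorm y * (4 * (1 + 1)).
  rewrite ler_wpM2l ?mulr_ge0 ?rnorm_ge0 //.
  by move: le; rewrite mul1r [X in X * _]mulrC.
have -> : rnorm x * rnorm y * ((rnorm x)^-1 * (rnorm y)^-1 * rnorm (inner x y))
  = rnorm (inner x y) by field; rewrite !gt_eqF.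
lra.
Qed.

End Norm.

Section Boundedness.
Variables (H K : hilbertModType A) (T : 'L(H, K)).
Implicit Types x y z : H.

Let unbounded := forall C, exists x, C * rnorm x < rnorm (T x).

Let large_nearby : unbounded -> forall x (r m : R), 0 < r ->
  exists2 x', rnorm (x' - x) <= r & m <= rnorm (T x').
Proof.
move=> unb x r m r0; have [z] := unb (2 * m / r).
have [->|z0] := eqVneq z 0; first by rewrite adj_fun0 !rnorm0; lra.
have Z0 := rnorm_gt0 z0; rewrite mulrAC ltr_pdivrMr // => zm.
pose w := (r / rnorm z)%:C *: z.
have rz0 : 0 <= r / rnorm z by rewrite divr_ge0 // ltW.
have wr : rnorm w = r by rewrite rnormZR_ge0 // divfK ?gt_eqF.
have wm : 2 * m <= rnorm (T w).
  rewrite adj_funZ rnormZR_ge0 // mulrAC ler_pdivlMr //; lra.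
have [xm|xm] := leP m (rnorm (T x)).
  by exists x => //; rewrite subrr rnorm0 ltW.
exists (x + w); first by rewrite addrC addKr wr.
have := rnormB (T (x + w)) (T x); rewrite -adj_funB addrC addKr.
rewrite addrC; lra.
Qed.

(** <T x, T y> is norm-continuous in y, being <T^* T x, y>; this is where the
   existence of the adjoint enters. *)
Let large_on_ball x : 0 < rnorm (T x) -> exists2 d : R, 0 < d &
  forall y, rnorm (y - x) <= d -> rnorm (T x) / 16 <= rnorm (T y).
Proof.
set m := rnorm (T x) => m0; pose k := rnorm (T^*L (T x)) + 1.
have k1 : 1 <= k by have := rnorm_ge0 (T^*L (T x)); rewrite /k; lra.
exists (m ^+ 2 / (16 * k)) => [|y yd].
  by rewrite divr_gt0 ?exprn_gt0 //; lra.
have := hilbert_cauchy_schwarz (T x) (T y).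
have := rnorm_triangle (inner (T x) (T x)) (inner (T x) (T y)).
have -> : inner (T x) (T x) - inner (T x) (T y) = inner (T^*L (T x)) (x - y).
  by rewrite -innerNr -innerDr -adj_funB inner_opadj.
rewrite rnorm_inner -/m.
have := hilbert_cauchy_schwarz (T^*L (T x)) (x - y).
move: yd; rewrite rnormBC ler_pdivlMr; last by lra.
have : rnorm (T^*L (T x)) <= k by rewrite /k; lra.
have := rnorm_ge0 (T^*L (T x)); have := rnorm_ge0 (x - y).
have := rnorm_ge0 (T y); move: (rnorm (inner _ _)) (rnorm (inner _ _)).
move: (rnorm (x - y)) (rnorm (T^*L _)) (rnorm (T y)).
move=> u v w i j w0 u0 v0 vk uk jv mi iw.
have : v * u <= k * u by rewrite ler_wpM2r.
nra.
Qed.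

(** A Baire category argument: were T unbounded, every ball would contain a
    smaller one on which rnorm (T y) exceeds any prescribed n, and a nested
    sequence of such balls has a common point. *)
Lemma adjointable_bounded :
  exists2 C, 0 < C & forall x, rnorm (T x) <= C * rnorm x.
Proof.
apply: contrapT => nb.
have unb : unbounded.
  move=> C; apply: contrapT => /forallNP bd; apply: nb.
  exists (`|C| + 1) => [|x]; first by have := normr_ge0 C; lra.
  have /negP := bd x; rewrite -leNgt => /le_trans; apply.
  by rewrite ler_wpM2r ?rnorm_ge0 //; have := ler_norm C; lra.
pose ball_in (s s' : H * R) := rnorm (s'.1 - s.1) + s'.2 <= s.2.
have step (ns : nat * (H * R)) : exists s' : H * R, 0 < ns.2.2 ->
    [/\ 0 < s'.2, s'.2 <= ns.2.2 / 2, ball_in ns.2 s'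
      & forall y, rnorm (y - s'.1) <= s'.2 -> ns.1%:R <= rnorm (T y)].
  case: ns => n [x r] /=.
  have [r0|r0] := ltP 0 r; last by exists (x, 0) => ?; lra.
  have [|x' xx' Tx'] := @large_nearby unb x (r / 2) (16 * n%:R + 1).
    by lra.
  have n0 : 0 <= n%:R :> R by [].
  have [|d d0 dT] := @large_on_ball x'; first by lra.
  exists (x', Num.min d (r / 2)) => _; rewrite /ball_in /=.
  have dr : Num.min d (r / 2) <= r / 2 by rewrite ge_min lexx orbT.
  split=> // [|| y yx'].
  - by rewrite lt_min d0; lra.
  - lra.
  - suff : rnorm (T x') / 16 <= rnorm (T y) by lra.
    by apply/dT/(le_trans yx'); rewrite ge_min lexx.
have [next nextP] := choice step.
pose s := fix s n := if n is m.+1 then next (m, s m) else (0 : H, 1 : R).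
have s0 n : 0 < (s n).2.
  by elim: n => [|n IH] /=; [exact: ltr01|case: (nextP (n, s n) IH)].
have s_small n : (s n).2 <= 2^-1 ^+ n.
  elim: n => [|n IH]; first by [].
  by have [_ + _ _] := nextP (n, s n) (s0 n); rewrite exprS /=; lra.
have [||x xs] := @nested_balls _ H (fun n => (s n).1) (fun n => (s n).2)
  (fun n => ltW (s0 n)).
- by move=> n; have [_ _ + _] := nextP (n, s n) (s0 n).
- move=> e e0; have [||n] := @exp_small R 2^-1 e _ _ e0; [lra|lra|].
  by exists n; apply: le_lt_trans (s_small n) _.
have large n : n%:R <= rnorm (T x).
  by have [_ _ _] := nextP (n, s n) (s0 n); apply; apply: (xs n.+1).
have := archi_boundP (rnorm_ge0 (T x)); by rewrite ltNge large.
Qed.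

End Boundedness.

End HilbertModules.
(** * Invertibility of a corner of a positive definite operator *)
Section Invertibility.
Variables (R : realType) (A : cstarAlgType R).

Lemma opinvP (H : formModType A) (T : 'L(H, H)) :
  (exists S, is_opinv T S) -> is_opinv T T^-1L.
Proof. by move=> [S TS]; apply: (xgetPex 0 (ex_intro _ S TS)). Qed.

Section CoercivePositive.
Variables (E : hilbertModType A) (T : 'L(E, E)) (c : R).
Hypotheses (T0 : oppos T) (c0 : 0 < c).
Hypothesis Tc : forall x, rnorm x ^+ 2 <= c * rnorm (inner x (T x)).
Implicit Types (x y z : E) (m : R).

Let shift m x := T x + m%:C *: x.

(** Since <x, T x> and m <x, x> are both positive, the sum dominates the first
   one, uniformly in m. *)
Let shift_lower m x : 0 <= m -> rnorm x <= 16 * c * rnorm (shift m x).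
Proof.
move=> m0; have [->|x0] := eqVneq x 0.
  by rewrite rnorm0 !mulr_ge0 ?rnorm_ge0 // ltW.
have X0 := rnorm_gt0 x0.
have mx : cpos (inner x (m%:C *: x)).
  have -> : inner x (m%:C *: x) =
      inner ((Num.sqrt m)%:C *: x) ((Num.sqrt m)%:C *: x).
    rewrite innerZl !innerZr conj_Creal ?complex_real // scalerA.
    by rewrite -rmorphM /= -expr2 sqr_sqrtr.
  exact: inner_pos.
have := cpos_norm_le (T0 x) mx; rewrite -innerDr -/(shift m x).
have := hilbert_cauchy_schwarz x (shift m x); have := Tc x.
move: (rnorm (inner x (T x))) (rnorm (inner x (shift m x))).
move: (rnorm (shift m x)) (rnorm x) X0 => s u u0 v w uv ws vw.
have cv : c * v <= c * (16 * u * s) by rewrite ler_wpM2l ?(ltW c0) //; lra.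
by rewrite -(ler_pM2l u0); nra.
Qed.

Let shiftB m x y : shift m (x - y) = shift m x - shift m y.
Proof. by rewrite /shift adj_funB; lmod R. Qed.

Let shift_surj m := forall y, exists x, shift m x = y.

Let shift_surj_large : exists2 m, 0 <= m & shift_surj m.
Proof.
have [C C0 TC] := adjointable_bounded T.
exists (2 * C) => [|y]; first by lra.
have m0 : 0 < (2 * C)^-1 by rewrite invr_gt0; lra.
have mC : (2 * C)%:C * ((2 * C)^-1)%:C = 1.
  by rewrite -rmorphM mulfV // gt_eqF //; lra.
have [|||x xy] := @neumann _ E (fun x => - (((2 * C)^-1)%:C *: T x)) (1 / 2)
   _ _ _ (((2 * C)^-1)%:C *: y).
- lra.
- by move=> u v; rewrite adj_funB; lmod R.
- move=> x; rewrite rnormN rnormZR_ge0 ?(ltW m0) //.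
  by rewrite ler_pdivrMl; have := TC x; lra.
exists x; rewrite -[RHS]scale1r -mC -scalerA -xy.
by rewrite scalerBr scalerN opprK scalerA mC scale1r addrC.
Qed.

(** The inverse G of T + m has norm at most 16 c, so a Neumann series inverts
   T + m' = (T + m) - (m - m') once (m - m') 16 c <= 1/2. *)
Let shift_surj_step m m' : 0 <= m' -> m' <= m -> (m - m') * (32 * c) <= 1 ->
  shift_surj m -> shift_surj m'.
Proof.
move=> m'0 mm' step msurj y.
have m0 : 0 <= m by lra.
have [G GK] := choice msurj.
have G_le z : rnorm (G z) <= 16 * c * rnorm z.
  by rewrite -{2}(GK z); apply: shift_lower.
have GB u v : G (u - v) = G u - G v.
  apply/eqP; rewrite -subr_eq0; apply/eqP/rnorm0_eq0.
  apply/eqP; rewrite eq_le rnorm_ge0 andbT.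
  apply: le_trans (shift_lower _ m0) _.
  by rewrite !shiftB !GK subrr rnorm0 mulr0.
have [|||z zy] := @neumann _ E (fun z => (m - m')%:C *: G z) (1 / 2) _ _ _ y.
- lra.
- by move=> u v; rewrite GB scalerBr.
- move=> x; rewrite rnormZR_ge0; last by lra.
  have : (m - m') * rnorm (G x) <= (m - m') * (16 * c * rnorm x).
    by rewrite ler_wpM2l //; lra.
  have := rnorm_ge0 x; nra.
exists (G z); rewrite -zy -{2}(GK z) /shift rmorphB; lmod R.
Qed.

Let surj : shift_surj 0.
Proof.
have [m m0 msurj] := shift_surj_large.
pose d := (32 * c)^-1; have d0 : 0 < d by rewrite invr_gt0 mulr_gt0.
have down n m' : 0 <= m' -> m' <= m -> m - n%:R * d <= m' -> shift_surj m'.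
  elim: n m' => [|n IH] m' m'0 m'm; first by move=> ?; have -> : m' = m by lra.
  rewrite -natr1 mulrDl mul1r => m'n.
  pose l := Num.min m (m' + d).
  have lm : l <= m by rewrite ge_min lexx.
  have ld : l <= m' + d by rewrite ge_min lexx orbT.
  have m'l : m' <= l by rewrite le_min m'm; lra.
  apply: (shift_surj_step m'0 m'l).
    by rewrite -ler_pdivlMr ?mulr_gt0 // div1r -/d; lra.
  apply: IH => //; first by lra.
  have nd : 0 <= n%:R * d by rewrite mulr_ge0 // ltW.
  by rewrite le_min; apply/andP; split; lra.
have [n mn] : exists n, m / d < n%:R.
  by exists (Num.bound (m / d)); exact: archi_boundP (divr_ge0 m0 (ltW d0)).
move: mn; rewrite (ltr_pdivrMr _ _ d0) => mn.
by apply: (down n 0 (lexx 0) m0); lra.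
Qed.

(** The method of continuity: T + m is onto for large m, and the lower bound of
    T + m is uniform in m >= 0, so surjectivity propagates down to m = 0 in
    steps of fixed length. The inverse of a self-adjoint bijection is its own
    adjoint. *)
Lemma coercive_invertible : exists S, is_opinv T S.
Proof.
have Tsurj y : exists x, T x = y.
  by have [x <-] := surj y; exists x; rewrite /shift scale0r addr0.
have [S SK] := choice Tsurj.
have Ts x y : inner (T x) y = inner x (T y).
  by rewrite adj_innerE -[adj_adj T]/(adj_fun T^*L) oppos_selfadj.
have Sadj x y : inner (S x) y = inner x (S y).
  by rewrite -{1}(SK y) -Ts SK.
exists (Adjointable Sadj); split; apply: adj_ext => x /=; last exact: SK.
apply/eqP; rewrite -subr_eq0; apply/eqP/rnorm0_eq0/eqP.
rewrite eq_le rnorm_ge0 andbT; apply: le_trans (shift_lower _ (lexx 0)) _.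
by rewrite /shift scale0r addr0 adj_funB SK subrr rnorm0 mulr0.
Qed.

End CoercivePositive.

(** Cauchy-Schwarz for the form of T between x and t P x, for which
    <x, T (t P x)> = t <x, x> and <t P x, T (t P x)> = t^2 <P x, x>. *)
Lemma oppos_inv_lower (E : formModType A) (T P : 'L(E, E)) (C : R) x :
    oppos T -> is_opinv T P -> 0 < C ->
    rnorm (inner (P x) x) <= C * rnorm (inner x x) ->
  rnorm (inner x x) <= 64 * C * rnorm (inner x (T x)).
Proof.
move=> T0 [_ TP] C0 PC.
have TPx : T (P x) = x := congr1 (fun S : 'L(_, _) => S x) TP.
(* With this t the term in t^2 absorbs half of the left-hand side. *)
pose t := (8 * C)^-1; have tC : t * (8 * C) = 1.
  by rewrite mulVf // gt_eqF //; lra.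
have t0 : 0 < t by rewrite invr_gt0; lra.
have := oppos_cauchy_schwarz T0 x (t%:C *: P x).
rewrite adj_funZ TPx !innerZr innerZl conj_Creal ?complex_real //.
rewrite !rnormZR_ge0 ?(ltW t0) //.
move: (rnorm (inner (P x) x)) (rnorm (inner x x)) (rnorm (inner x (T x))) PC.
move=> p s n ps le.
have : t * (t * p) <= t * (t * (C * s)) by rewrite !(ler_wpM2l (ltW t0)).
have -> : t * (t * (C * s)) = t * (t * (8 * C)) * s / 8 by field.
rewrite tC mulr1 => ?; have {}le : t * s <= 8 * n by lra.
have : 8 * C * (t * s) <= 8 * C * (8 * n) by rewrite ler_wpM2l //; lra.
have -> : 8 * C * (t * s) = t * (8 * C) * s by ring.
rewrite tC; lra.
Qed.

Lemma inner_opblock_corner (H1 H2 : formModType A) (N11 : 'L(H1, H1))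
    (N12 : 'L(H2, H1)) (N21 : 'L(H1, H2)) (N22 : 'L(H2, H2)) (x : H1) :
  inner ((x, 0) : dsum H1 H2) (opblock N11 N12 N21 N22 (x, 0))
    = inner x (N11 x).
Proof. by rewrite inner_dsum /= inner0l addr0 adj_fun0 addr0. Qed.

Lemma oppos_corner (H1 H2 : formModType A) (N11 : 'L(H1, H1))
    (N12 : 'L(H2, H1)) (N21 : 'L(H1, H2)) (N22 : 'L(H2, H2)) :
  oppos (opblock N11 N12 N21 N22) -> oppos N11.
Proof. by move=> N0 x; rewrite -(inner_opblock_corner N11 N12 N21 N22). Qed.

(** A positive definite N is coercive on the vectors (x, 0), where its form is
    that of N11; only the (1,1) block of N^-1 has to be bounded for this. *)
Lemma opposdef_corner (H1 H2 : hilbertModType A) (N11 : 'L(H1, H1))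
    (N12 : 'L(H2, H1)) (N21 : 'L(H1, H2)) (N22 : 'L(H2, H2)) :
  opposdef (opblock N11 N12 N21 N22) -> is_opinv N11 N11^-1L.
Proof.
set N := opblock _ _ _ _ => -[N0 [P NP]]; apply: opinvP.
have [C C0 PC] := adjointable_bounded (blk11 P).
apply: (@coercive_invertible H1 N11 (64 * (8 * C)) (oppos_corner N0)).
  by lra.
move=> x; rewrite -(inner_opblock_corner N11 N12 N21 N22) -rnorm_inner.
have -> : inner x x = inner ((x, 0) : dsum H1 H2) (x, 0).
  by rewrite inner_dsum /= inner0l addr0.
apply: oppos_inv_lower N0 NP _ _; first by lra.
rewrite !inner_dsum /= !inner0r !addr0 rnorm_inner.
have := hilbert_cauchy_schwarz (blk11 P x) x; rewrite /=.
have := PC x; rewrite /= expr2; have := rnorm_ge0 x; nra.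
Qed.

End Invertibility.
(** * The algebra of adjointable operators *)
Section OperatorAlgebra.
Variables (R : realType) (A : cstarAlgType R).
Implicit Types H K L : formModType A.

Lemma opzeroE H K (x : H) : (0 : 'L(H, K)) x = 0.
Proof. by []. Qed.

Lemma opaddE H K (S T : 'L(H, K)) x : (S + T) x = S x + T x.
Proof. by []. Qed.

Lemma opoppE H K (S : 'L(H, K)) x : (- S) x = - S x.
Proof. by []. Qed.

Lemma opadjE H K (S : 'L(H, K)) : adj_adj S = S^*L.
Proof. by []. Qed.

Lemma opblockE H1 H2 K1 K2 (T11 : 'L(H1, K1)) (T12 : 'L(H2, K1))
    (T21 : 'L(H1, K2)) (T22 : 'L(H2, K2)) x1 x2 :
  opblock T11 T12 T21 T22 (x1, x2) = (T11 x1 + T12 x2, T21 x1 + T22 x2).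
Proof. by []. Qed.

Lemma opblock_adj H1 H2 K1 K2 (T11 : 'L(H1, K1)) (T12 : 'L(H2, K1))
    (T21 : 'L(H1, K2)) (T22 : 'L(H2, K2)) :
  (opblock T11 T12 T21 T22)^*L = opblock T11^*L T21^*L T12^*L T22^*L.
Proof. exact: adj_ext. Qed.

Lemma opcompE H K L (S : 'L(K, L)) (T : 'L(H, K)) x : (S \oL T) x = S (T x).
Proof. by []. Qed.

Lemma opidE H (x : H) : opid x = x.
Proof. by []. Qed.

Lemma opadj0 H K : (0 : 'L(H, K))^*L = 0.
Proof. exact: adj_ext. Qed.

Lemma opcompA H1 H2 H3 H4 (S : 'L(H3, H4)) (T : 'L(H2, H3)) (U : 'L(H1, H2)) :
  S \oL (T \oL U) = S \oL T \oL U.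
Proof. exact: adj_ext. Qed.

Lemma opcomp1l H K (T : 'L(H, K)) : opid \oL T = T.
Proof. exact: adj_ext. Qed.

Lemma opcomp1r H K (T : 'L(H, K)) : T \oL opid = T.
Proof. exact: adj_ext. Qed.

Lemma opadjM H K L (S : 'L(K, L)) (T : 'L(H, K)) :
  (S \oL T)^*L = T^*L \oL S^*L.
Proof. exact: adj_ext. Qed.

Lemma opadjK H K (T : 'L(H, K)) : T^*L^*L = T.
Proof. exact: adj_ext. Qed.

Lemma opadj1 H : (@opid _ _ H)^*L = opid.
Proof. exact: adj_ext. Qed.

Lemma opinv_selfadj H (T S : 'L(H, H)) : T^*L = T -> is_opinv T S -> S^*L = S.
Proof.
move=> Ts [ST TS]; have : S^*L \oL (T \oL S) = S^*L by rewrite TS opcomp1r.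
by rewrite opcompA -{1}Ts -opadjM TS opadj1 opcomp1l.
Qed.

Definition opE := (opblockE, opzeroE, opaddE, opoppE, opcompE, opidE).

End OperatorAlgebra.

(** * Weighted Moore-Penrose inverses under congruence of the weights *)
Section WeightedInverse.
Variables (R : realType) (A : cstarAlgType R).
Variables (H K : formModType A).

(** T X and T Y are idempotents with the same range, self-adjoint for the form
    of M, hence equal; likewise X T = Y T, and X = X T X = Y T Y = Y. *)
Lemma is_wMP_unique (M : 'L(K, K)) (N : 'L(H, H)) (T : 'L(H, K)) X Y :
    M^*L = M -> N^*L = N -> (exists S, is_opinv M S) ->
    (exists S, is_opinv N S) ->
  is_wMP M N T X -> is_wMP M N T Y -> X = Y.
Proof.
move=> Ms Ns [M' [M'M _]] [N' [N'N _]] [TXT XTX MX NX] [TYT YTY MY NY].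
have TXY : T \oL X = T \oL Y.
  have MTX : (T \oL X)^*L \oL M = M \oL T \oL X.
    by rewrite -MX -opcompA [RHS]opadjM Ms.
  have MTY : (T \oL Y)^*L \oL M = M \oL T \oL Y.
    by rewrite -MY -opcompA [RHS]opadjM Ms.
  rewrite -[LHS]opcomp1l -[RHS]opcomp1l -M'M -!opcompA; congr (_ \oL _).
  rewrite !opcompA -{1}TYT !opcompA -MTY -!opcompA.
  rewrite [M \oL (T \oL X)]opcompA -MTX.
  by rewrite opcompA -opadjM opcompA TXT MTY.
have XYT : X \oL T = Y \oL T.
  have NXT : (X \oL T)^*L \oL N = N \oL X \oL T.
    by rewrite -NX -opcompA [RHS]opadjM Ns.
  have NYT : (Y \oL T)^*L \oL N = N \oL Y \oL T.
    by rewrite -NY -opcompA [RHS]opadjM Ns.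
  rewrite -[LHS]opcomp1l -[RHS]opcomp1l -N'N -!opcompA; congr (_ \oL _).
  rewrite -{1}TYT !opcompA -NXT -!opcompA [N \oL (Y \oL T)]opcompA -NYT.
  by rewrite opcompA -opadjM -opcompA [T \oL (X \oL T)]opcompA TXT.
by rewrite -XTX -opcompA TXY opcompA XYT YTY.
Qed.

(** U is an isometry from the weight U^* N U to the weight N, and V likewise, so
    the four conditions for Y are transported to U^-1 Y V. *)
Lemma is_wMP_congr (U U' : 'L(H, H)) (V V' : 'L(K, K)) (M : 'L(K, K))
    (N : 'L(H, H)) (T : 'L(H, K)) Y :
    is_opinv U U' -> is_opinv V V' ->
    is_wMP M N (V \oL T \oL U') Y ->
  is_wMP (V^*L \oL M \oL V) (U^*L \oL N \oL U) T (U' \oL Y \oL V).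
Proof.
move=> [U'U UU'] [V'V VV'] [BYB YBY MBY NYB]; split.
- have := congr1 (fun S => V' \oL S \oL U) BYB.
  by rewrite !opcompA V'V !opcomp1l -!opcompA U'U !opcomp1r !opcompA.
- by rewrite -{3}YBY !opcompA.
- have -> : V^*L \oL M \oL V \oL T \oL (U' \oL Y \oL V)
      = V^*L \oL (M \oL (V \oL T \oL U') \oL Y) \oL V by rewrite !opcompA.
  by rewrite !(opadjM _ V) (opadjM V^*L) MBY opadjK opcompA.
- have -> : U^*L \oL N \oL U \oL (U' \oL Y \oL V) \oL T
      = U^*L \oL (N \oL Y \oL (V \oL T \oL U')) \oL U.
    rewrite !opcompA -[_ \oL U \oL U']opcompA UU' opcomp1r.
    by rewrite -[_ \oL U' \oL U]opcompA U'U opcomp1r.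
  by rewrite (opadjM _ U) (opadjM U^*L) NYB opadjK opcompA.
Qed.

(** The congruence of weights is reversible, so one side has a weighted inverse
    exactly when the other one has; when neither has, both sides are the default
    value 0. *)
Lemma wMP_congr (M : 'L(K, K)) (N : 'L(H, H)) (DM : 'L(K, K)) (DN : 'L(H, H))
    (T : 'L(H, K)) (U U' : 'L(H, H)) (V V' : 'L(K, K)) :
    M = V^*L \oL DM \oL V -> N = U^*L \oL DN \oL U ->
    is_opinv U U' -> is_opinv V V' -> opposdef M -> opposdef N ->
  wMP M N T = U' \oL wMP DM DN (V \oL T \oL U') \oL V.
Proof.
move=> ME NE Uinv Vinv [M0 Minv] [N0 Ninv].
have [U'U UU'] := Uinv; have [V'V VV'] := Vinv.
have [[X TX]|noX] := pselect (exists X, is_wMP M N T X).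
  have TwMP : is_wMP M N T (wMP M N T) := xgetPex 0 (ex_intro _ X TX).
  have [Y BY] : exists Y, is_wMP DM DN (V \oL T \oL U') Y.
    exists (U \oL X \oL V').
    have -> : DM = V'^*L \oL M \oL V'.
      rewrite ME !opcompA -opadjM VV' opadj1 opcomp1l -opcompA VV'.
      by rewrite opcomp1r.
    have -> : DN = U'^*L \oL N \oL U'.
      rewrite NE !opcompA -opadjM UU' opadj1 opcomp1l -opcompA UU'.
      by rewrite opcomp1r.
    apply: (@is_wMP_congr U' U V' V); [by split|by split|].
    rewrite !opcompA V'V opcomp1l -opcompA U'U opcomp1r //.
  have BwMP : is_wMP DM DN (V \oL T \oL U') (wMP DM DN (V \oL T \oL U')) :=
    xgetPex 0 (ex_intro _ Y BY).
  apply: (is_wMP_unique (oppos_selfadj M0) (oppos_selfadj N0) Minv Ninv TwMP).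
  by rewrite ME NE; exact: is_wMP_congr Uinv Vinv BwMP.
have wMP0 : wMP M N T = 0.
  by rewrite /wMP xgetPN // => X TX; apply: noX; exists X.
rewrite wMP0 [wMP DM _ _]/wMP xgetPN.
  by apply: adj_ext => x /=; rewrite adj_fun0.
move=> Y BY; apply: noX; exists (U' \oL Y \oL V).
by rewrite ME NE; exact: is_wMP_congr Uinv Vinv BY.
Qed.

End WeightedInverse.

(** * Block matrices and the theorem *)
Section Blocks.
Variables (R : realType) (A : cstarAlgType R).

Definition opshear (H1 H2 : formModType A) (F : 'L(H2, H1)) :
  'L(dsum H1 H2, dsum H1 H2) := opblock opid F 0 opid.

Lemma opshearE (H1 H2 : formModType A) (F : 'L(H2, H1)) x1 x2 :
  opshear F (x1, x2) = (x1 + F x2, x2).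
Proof. by rewrite /opshear !opE add0r. Qed.

Lemma opshear_inv (H1 H2 : formModType A) (F : 'L(H2, H1)) :
  is_opinv (opshear F) (opshear (- F)).
Proof.
by split; apply: adj_ext => -[x1 x2];
  rewrite opcompE !opshearE opE ?addrK ?subrK.
Qed.

(** The block LDL factorization, with the unipotent factor F = N11^-1 N12. *)
Lemma opblock_schur (H1 H2 : hilbertModType A) (N11 : 'L(H1, H1))
    (N12 : 'L(H2, H1)) (N22 : 'L(H2, H2)) :
  opposdef (opblock N11 N12 N12^*L N22) ->
  opblock N11 N12 N12^*L N22 =
    (opshear (N11^-1L \oL N12))^*L \oL opdiag N11 (schur N11 N12 N22)
      \oL opshear (N11^-1L \oL N12).
Proof.
move=> Npos; have N11inv := opposdef_corner Npos; have [SN NS] := N11inv.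
have Ns := oppos_selfadj (oppos_corner (proj1 Npos)).
have Ss := opinv_selfadj Ns N11inv.
have NSE x : N11 (N11^-1L x) = x := congr1 (fun S : 'L(_, _) => S x) NS.
have SNE x : N11^-1L (N11 x) = x := congr1 (fun S : 'L(_, _) => S x) SN.
rewrite /opshear /opdiag opblock_adj opadjM Ss opadj0 !opadj1.
apply: adj_ext => -[x1 x2]; rewrite /schur !opE /= ?opadjE !add0r !addr0.
by rewrite adj_funD NSE !adj_funD SNE; congr pair; lmod R.
Qed.

Section BlockDecomposition.
Variables (H1 H2 K1 K2 : formModType A).

Lemma opblock_blk (T : 'L(dsum H1 H2, dsum K1 K2)) :
  opblock (blk11 T) (blk12 T) (blk21 T) (blk22 T) = T.
Proof.
apply: adj_ext => -[x1 x2].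
have -> : (x1, x2) = (x1, 0) + (0, x2) :> dsum H1 H2.
  by congr pair; rewrite /= (addr0, add0r).
by rewrite (adj_funD T) /=; congr pair; rewrite /= addr0 add0r.
Qed.

Variables (T11 : 'L(H1, K1)) (T12 : 'L(H2, K1)).
Variables (T21 : 'L(H1, K2)) (T22 : 'L(H2, K2)).

Lemma blk11_opblock : blk11 (opblock T11 T12 T21 T22) = T11.
Proof. by apply: adj_ext => x; rewrite /= adj_fun0 addr0. Qed.

Lemma blk12_opblock : blk12 (opblock T11 T12 T21 T22) = T12.
Proof. by apply: adj_ext => x; rewrite /= adj_fun0 add0r. Qed.

Lemma blk21_opblock : blk21 (opblock T11 T12 T21 T22) = T21.
Proof. by apply: adj_ext => x; rewrite /= adj_fun0 addr0. Qed.

Lemma blk22_opblock : blk22 (opblock T11 T12 T21 T22) = T22.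
Proof. by apply: adj_ext => x; rewrite /= adj_fun0 add0r. Qed.

End BlockDecomposition.

End Blocks.

Theorem mainTheorem2 (R : realType) (A : cstarAlgType R)
    (H1 H2 K1 K2 : hilbertModType A)
    (N11 : 'L(H1, H1)) (N12 : 'L(H2, H1)) (N22 : 'L(H2, H2))
    (M11 : 'L(K1, K1)) (M12 : 'L(K2, K1)) (M22 : 'L(K2, K2))
    (A11 : 'L(H1, K1)) (A12 : 'L(H2, K1))
    (A21 : 'L(H1, K2)) (A22 : 'L(H2, K2)) :
  let N := opblock N11 N12 N12^*L N22 in
  let M := opblock M11 M12 M12^*L M22 in
  let T := opblock A11 A12 A21 A22 in
  opposdef N -> opposdef M -> closed_range T ->
  let SN := schur N11 N12 N22 in
  let SM := schur M11 M12 M22 in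
  let B11 := A11 + M11^-1L \oL M12 \oL A21 in
  let B12 := A12 + M11^-1L \oL M12 \oL A22 - A11 \oL N11^-1L \oL N12
             - M11^-1L \oL M12 \oL A21 \oL N11^-1L \oL N12 in
  let B21 := A21 in
  let B22 := A22 - A21 \oL N11^-1L \oL N12 in
  let B := opblock B11 B12 B21 B22 in
  let Bd := wMP (opdiag M11 SM) (opdiag N11 SN) B in
  let Td := wMP M N T in
  [/\ blk11 Td = blk11 Bd - N11^-1L \oL N12 \oL blk21 Bd,
      blk12 Td = blk11 Bd \oL M11^-1L \oL M12 + blk12 Bd
                 - N11^-1L \oL N12 \oL blk21 Bd \oL M11^-1L \oL M12
                 - N11^-1L \oL N12 \oL blk22 Bd,
      blk21 Td = blk21 Bd
    & blk22 Td = blk21 Bd \oL M11^-1L \oL M12 + blk22 Bd].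
Proof.
move=> N M T Npos Mpos _ SN SM B11 B12 B21 B22 B Bd Td.
pose F := N11^-1L \oL N12; pose G := M11^-1L \oL M12.
have BE : B = opshear G \oL T \oL opshear (- F).
  apply: adj_ext => -[x1 x2]; rewrite !opcompE opshearE /T opblockE opshearE.
  rewrite /B /B11 /B12 /B21 /B22 /F /G !opE !(adj_funD, adj_funN).
  by congr pair => /=; lmod R.
have : Td = opshear (- F) \oL Bd \oL opshear G.
  rewrite /Bd BE.
  by apply: wMP_congr; [exact: opblock_schur|exact: opblock_schur
    |exact: opshear_inv|exact: opshear_inv|exact: Mpos|exact: Npos].
have TdE : opshear (- F) \oL Bd \oL opshear G
    = opblock (blk11 Bd - F \oL blk21 Bd)
        (blk11 Bd \oL G + blk12 Bd - F \oL blk21 Bd \oL G - F \oL blk22 Bd)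
        (blk21 Bd) (blk21 Bd \oL G + blk22 Bd).
  rewrite -{1}(opblock_blk Bd); apply: adj_ext => -[x1 x2].
  rewrite !opcompE opshearE [X in opshear _ X]opblockE opshearE.
  rewrite [RHS]opblockE !opE.
  move: (blk11 Bd) (blk12 Bd) (blk21 Bd) (blk22 Bd) => b11 b12 b21 b22.
  by rewrite !(adj_funD, adj_funN); congr pair => /=; lmod R.
rewrite TdE => ->.
rewrite blk11_opblock blk12_opblock blk21_opblock blk22_opblock /F /G !opcompA.
by split.
Qed.
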